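(* Let $d\in\mathbb{N}$, let $(M_p)_{p\in\mathbb{N}_0}$ be a sequence of positive numbers with $M_0=1$ satisfying (M.1), (M.2) and (M.3), and let $T\in\mathcal{D}'^{\{M_p\}}_d$ be a Roumieu ultradistribution on $\mathbb{R}^d$. Then the following conditions are equivalent: (a) the functional $T$ is continuous on $\mathcal{D}^{\{M_p\}}_d$ in the topology induced by $\dot{\mathcal{B}}^{\{M_p\}}_d$, i.e. there exist $(r_p)\in\mathfrak{R}$ and $C>0$ such that $|\langle T,\varphi\rangle|\le C\|\varphi\|_{(r_p)}$ for all $\varphi\in\mathcal{D}^{\{M_p\}}_d$; (b) there exists $(r_p)\in\mathfrak{R}$ such that for every $\varepsilon>0$ there is a regular compact set $K\subset\mathbb{R}^d$ for which the inequality $|\langle T,\varphi\rangle|\le\varepsilon\|\varphi\|_{(r_p)}$ holds for all $\varphi\in\mathcal{D}^{\{M_p\}}_d$ satisfying $\operatorname{supp}\varphi\cap K=\emptyset$; (c) the sequence of numbers $(\langle T,\Pi_n\rangle)_{n\in\mathbb{N}}$ is Cauchy for each $\mathfrak{R}$-approximate unit $(\Pi_n)\in\mathbb{U}^{\{M_p\}}_d$; (d) the sequence of numbers $(\langle T,\Pi_n\rangle)_{n\in\mathbb{N}}$ is Cauchy for each special $\mathfrak{R}$-approximate unit $(\Pi_n)\in\overline{\mathbb{U}}^{\{M_p\}}_d$; (e) there exist $(r_p)\in\mathfrak{R}$, $C>0$ and a regular compact set $K\subset\mathbb{R}^d$ such that $|\langle T,\varphi\rangle|\le C\|\varphi\|_{(r_p)}$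 for all $\varphi\in\mathcal{D}^{\{M_p\}}_d$ satisfying $\operatorname{supp}\varphi\cap K=\emptyset$.
   Context: Conditions on $(M_p)$: for some constants $A>0$, $H\ge 1$, (M.1) $M_p^2\le M_{p-1}M_{p+1}$ for $p\in\mathbb{N}$; (M.2) $M_p\le AH^pM_qM_{p-q}$ for $p,q\in\mathbb{N}_0$, $q\le p$; (M.3) $\sum_{p=q+1}^\infty M_{p-1}M_p^{-1}\le AqM_qM_{q+1}^{-1}$ for $q\in\mathbb{N}$. For $k=(k_1,\dots,k_d)\in\mathbb{N}_0^d$ put $|k|=k_1+\dots+k_d$, $M_k:=M_{|k|}$ and $D^k=\left(\frac1i\frac{\partial}{\partial x_1}\right)^{k_1}\cdots\left(\frac1i\frac{\partial}{\partial x_d}\right)^{k_d}$. All functions are complex-valued; $\|\varphi\|_\infty=\sup_{x\in\mathbb{R}^d}|\varphi(x)|$ and $\|\varphi\|_K=\sup_{x\in K}|\varphi(x)|$. Class $\mathfrak{R}$: the set of all real sequences $(r_p)_{p\in\mathbb{N}_0}$ with $r_0=1$ which monotonically increase to infinity. The product sequence of $(r_p)$ is $R_p:=\prod_{i=0}^pr_i$. For smooth $\varphi$ on $\mathbb{R}^d$, $\|\varphi\|_{(r_p)}:=\sup_{k\in\mathbb{N}_0^d}\frac{\|D^k\varphi\|_\infty}{R_{|k|}M_k}$. Regular compact set: a compact set that is regular in the sense usual in Komatsu's theory of ultradistributions, i.e. $K$ is the closure of its interior, has finitely many connected components, and there is a constant $c$ such that any two points $x,y$ of the same component can be joined by a rectifiable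 curve in $K$ of length at most $c|x-y|$ (for instance, a closed ball). Spaces. For $K\subset\mathbb{R}^d$ regular compact and $h>0$ let $q_{K,h}(\varphi):=\sup_{k\in\mathbb{N}_0^d}\frac{\|D^k\varphi\|_K}{h^{|k|}M_k}$. $\mathcal{E}^{\{M_p\}}_{K,h,d}$ is the space of smooth $\varphi$ on $\mathbb{R}^d$ with $q_{K,h}(\varphi)<\infty$, topologized by the seminorm $q_{K,h}$. $\mathcal{D}^{\{M_p\}}_{K,h,d}$ is the Banach space of those smooth $\varphi$ with $q_{K,h}(\varphi)<\infty$ and support in $K$, with norm $q_{K,h}$. Then (as locally convex limits) $\mathcal{D}^{\{M_p\}}_{K,d}=\varinjlim_{h\to\infty}\mathcal{D}^{\{M_p\}}_{K,h,d}$, $\mathcal{D}^{\{M_p\}}_d=\varinjlim_{K\subset\subset\mathbb{R}^d}\mathcal{D}^{\{M_p\}}_{K,d}$, $\mathcal{E}^{\{M_p\}}_d=\varprojlim_{K\subset\subset\mathbb{R}^d}\varinjlim_{h\to\infty}\mathcal{E}^{\{M_p\}}_{K,h,d}$, where $K$ grows up to $\mathbb{R}^d$. $\mathcal{D}^{\{M_p\}}_{L^\infty,d}=\varinjlim_{h\to\infty}\mathcal{D}^{\{M_p\}}_{L^\infty,h,d}$, where $\mathcal{D}^{\{M_p\}}_{L^\infty,h,d}$ is the Banach space of smooth $\varphi$ on $\mathbb{R}^d$ with norm $\sup_{k}\frac{\|D^k\varphi\|_\infty}{h^{|k|}M_k}<\infty$. It is a known fact that, as a locally convex space, $\mathcal{D}^{\{M_p\}}_{L^\infty,d}=\varprojlim_{(r_p)\in\mathfrak{R}}\mathcal{D}^{\{M_p\}}_{L^\infty,(r_p),d}$,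 where $\mathcal{D}^{\{M_p\}}_{L^\infty,(r_p),d}$ is the Banach space of smooth $\varphi$ with $\|\varphi\|_{(r_p)}<\infty$; thus its topology is given by the norms $\|\cdot\|_{(r_p)}$, $(r_p)\in\mathfrak{R}$. $\dot{\mathcal{B}}^{\{M_p\}}_d$ is the completion of $\mathcal{D}^{\{M_p\}}_d$ in $\mathcal{D}^{\{M_p\}}_{L^\infty,d}$. Roumieu ultradistributions are the elements of the strong dual $\mathcal{D}'^{\{M_p\}}_d$ of $\mathcal{D}^{\{M_p\}}_d$; $\langle T,\varphi\rangle$ is the value of $T$ at $\varphi$. An $\mathfrak{R}$-approximate unit is a sequence $(\Pi_n)_{n\in\mathbb{N}}$ of functions $\Pi_n\in\mathcal{D}^{\{M_p\}}_d$ which converges to the constant function $1$ in $\mathcal{E}^{\{M_p\}}_d$ and satisfies $\sup_{n\in\mathbb{N}}\|\Pi_n\|_{(r_p)}<\infty$ for each $(r_p)\in\mathfrak{R}$. It is called special if, in addition, for each compact $K\subset\mathbb{R}^d$ there is $n_0\in\mathbb{N}$ such that $\Pi_n(x)=1$ for all $n\ge n_0$ and $x\in K$. $\mathbb{U}^{\{M_p\}}_d$ and $\overline{\mathbb{U}}^{\{M_p\}}_d$ denote the classes of all $\mathfrak{R}$-approximate units and of all special $\mathfrak{R}$-approximate units on $\mathbb{R}^d$, respectively. *)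

(* Defs.v *)
From mathcomp Require Import all_boot all_order all_algebra.
From mathcomp Require Import all_classical all_reals all_analysis.
From mathcomp Require Import complex.

Set Implicit Arguments.
Unset Strict Implicit.
Unset Printing Implicit Defensive.
Import Order.TTheory GRing.Theory Num.Theory.
Import numFieldNormedType.Exports.

Local Open Scope classical_set_scope.
Local Open Scope ring_scope.

Notation cmod := ComplexField.Normc.normc.

(** All the spaces below are linear subspaces of one fixed vector space [V] and all
the linking maps of the limits are inclusions. A locally convex space is given
by its underlying subset of [V] and by the set of all its continuous
seminorms; the values of a seminorm outside the carrier are irrelevant. *)

Section LocallyConvex.
Variables (R : realType) (V : lmodType R[i]).

Record lcs := Lcs { carrier : set V; cseminorm : set (V -> R) }.

Definition seminorm_on (E : set V) (p : V -> R) : Prop :=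
  [/\ forall x, E x -> 0 <= p x,
      forall (a : R[i]) x, E x -> p (a *: x) = cmod a * p x &
      forall x y, E x -> E y -> p (x + y) <= p x + p y].

(** The subspace of [E] on which the extended seminorm [q] is finite. *)
Definition seminormed_space (E : set V) (q : V -> \bar R) : lcs :=
  let F := [set x | E x /\ (q x < +oo)%E] in
  Lcs F [set p | seminorm_on F p /\
    exists C : R, forall x, F x -> ((p x)%:E <= C%:E * q x)%E].

(** Inductive limit of the [X i], [i] in [J], a family directed for the
inclusion of the carriers (so that their union is a subspace): the topology is
the finest locally convex one for which all the inclusions are continuous. *)
Definition ind_lim (I : Type) (J : set I) (X : I -> lcs) : lcs :=
  let E := \bigcup_(i in J) carrier (X i) in
  Lcs E [set p | seminorm_on E p /\ forall i, J i -> cseminorm (X i) p].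

(** Projective limit: the coarsest locally convex topology on the intersection
for which all the inclusions into the [X i] are continuous. *)
Definition proj_lim (I : Type) (J : set I) (X : I -> lcs) : lcs :=
  let E := \bigcap_(i in J) carrier (X i) in
  Lcs E [set p | seminorm_on E p /\
    exists (n : nat) (i : 'I_n -> I) (q : 'I_n -> V -> R),
      (forall j, J (i j) /\ cseminorm (X (i j)) (q j)) /\
      (forall x, E x -> p x <= \sum_(j < n) q j x)].

Definition lcs_cvg (X : lcs) (u : nat -> V) (l : V) : Prop :=
  [/\ forall n, carrier X (u n), carrier X l &
      forall p, cseminorm X p -> p (u n - l) @[n --> \oo] --> (0 : R)].

(** Elements of the dual of [X]; the values of [T] outside the carrier are
irrelevant. *)
Definition in_dual (X : lcs) (T : V -> R[i]) : Prop :=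
  (forall (a : R[i]) x y, carrier X x -> carrier X y ->
     T (a *: x + y) = a * T x + T y) /\
  (exists2 p, cseminorm X p & forall x, carrier X x -> cmod (T x) <= p x).

End LocallyConvex.

Section RegularCompact.
Variables (R : realType) (d : nat).

Definition eucl_norm (v : 'rV[R]_d) : R := Num.sqrt (\sum_(j < d) v 0 j ^+ 2).

Definition curve_length (g : R -> 'rV[R]_d) : \bar R :=
  ereal_sup [set (\sum_(0 <= m < size s)
      eucl_norm (g (nth 1 (0 :: s) m.+1) - g (nth 1 (0 :: s) m)))%:E
    | s in [set s : seq R | itv_partition 0 1 s]].

Definition regular_compact (K : set 'rV[R]_d) : Prop :=
  [/\ compact K,
      closure (interior K) = K,
      finite_set [set connected_component K x | x in K] &
      exists c : R, forall x y, K x -> connected_component K x y ->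
        exists g : R -> 'rV[R]_d,
          [/\ {within `[0, 1], continuous g},
              g @` `[0, 1] `<=` K, g 0 = x, g 1 = y &
              (curve_length g <= (c * eucl_norm (x - y))%:E)%E]].

End RegularCompact.

(** [R[i]^o] is the complex field as a module over itself. It carries no
structure of normed space over [R], so that differentiation with respect to the
real variables is done on real and imaginary parts. *)
Notation cfun R d := ('rV[R]_d -> R[i]^o).

Section Smooth.
Variables (R : realType) (d : nat).
Implicit Types (f : cfun R d) (K : set 'rV[R]_d).

Definition re_part f : 'rV[R]_d -> R := fun x => complex.Re (f x).
Definition im_part f : 'rV[R]_d -> R := fun x => complex.Im (f x).

Definition partial (j : 'I_d) f : cfun R d := fun x =>
  ('D_(delta_mx 0 j) (re_part f) x +i* 'D_(delta_mx 0 j) (im_part f) x)%C.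

Definition smooth f : Prop := forall s : seq 'I_d,
  let g := foldr partial f s in
  [/\ continuous (re_part g), continuous (im_part g) &
      forall (j : 'I_d) x, derivable (re_part g) x (delta_mx 0 j) /\
                           derivable (im_part g) x (delta_mx 0 j)].

Definition Dop (j : 'I_d) f : cfun R d := ('i%C)^-1 *: partial j f.

Definition multi_D (k : {ffun 'I_d -> nat}) f : cfun R d :=
  foldr (fun j g => iter (k j) (Dop j) g) f (enum 'I_d).

(** The element [0] only matters for empty [K], where the supremum, taken in
[[0, +oo]], is [0]. *)
Definition sup_norm K f : \bar R :=
  ereal_sup (0%E |` [set (cmod (f x))%:E | x in K]).

Definition weighted_norm K (w : nat -> R) f : \bar R :=
  ereal_sup [set (sup_norm K (multi_D k f) *
                  ((w (\sum_(j < d) k j)%N)^-1)%:E)%E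
            | k in [set: {ffun 'I_d -> nat}]].

Definition supp f : set 'rV[R]_d := closure [set x | f x != 0].

End Smooth.

Section Roumieu.
Variables (R : realType) (d : nat).
Implicit Types (M r : nat -> R) (K : set 'rV[R]_d).

Definition M1 M : Prop :=
  forall p, (0 < p)%N -> M p ^+ 2 <= M p.-1 * M p.+1.

Definition M2 (A H : R) M : Prop :=
  forall p q, (q <= p)%N -> M p <= A * H ^+ p * M q * M (p - q)%N.

Definition M3 (A : R) M : Prop := forall q, (0 < q)%N ->
  (\sum_(q.+1 <= p <oo) (M p.-1 / M p)%:E
     <= (A * q%:R * M q / M q.+1)%:E)%E.

Definition classR : set (nat -> R) :=
  [set r | [/\ r 0 = 1, {homo r : m n / (m <= n)%N >-> m <= n} &
               r n @[n --> \oo] --> +oo]].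

Definition product_seq r (p : nat) : R := \prod_(0 <= i < p.+1) r i.

Definition R_norm M r (f : cfun R d) : \bar R :=
  weighted_norm setT (fun p => product_seq r p * M p) f.

Definition q_norm M K (h : R) (f : cfun R d) : \bar R :=
  weighted_norm K (fun p => h ^+ p * M p) f.

Definition E_Kh M K h : lcs (cfun R d) :=
  seminormed_space [set f | smooth f] (q_norm M K h).

Definition D_Kh M K h : lcs (cfun R d) :=
  seminormed_space [set f | smooth f /\ supp f `<=` K] (q_norm M K h).

Definition D_K M K : lcs (cfun R d) := ind_lim [set h : R | 0 < h] (D_Kh M K).

Definition D_space M : lcs (cfun R d) :=
  ind_lim [set K | regular_compact K] (D_K M).

Definition E_space M : lcs (cfun R d) :=
  proj_lim [set K | regular_compact K]
    (fun K => ind_lim [set h : R | 0 < h] (E_Kh M K)).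

Definition test_function M : set (cfun R d) := carrier (D_space M).

Definition ultradistribution M (T : cfun R d -> R[i]) : Prop :=
  in_dual (D_space M) T.

Definition approximate_unit M (P : nat -> cfun R d) : Prop :=
  [/\ forall n, test_function M (P n),
      lcs_cvg (E_space M) P (fun=> 1) &
      forall r, classR r ->
        (ereal_sup (range (fun n => R_norm M r (P n))) < +oo)%E].

Definition special_approximate_unit M (P : nat -> cfun R d) : Prop :=
  approximate_unit M P /\
  forall K, compact K -> exists n0 : nat,
    forall n x, (n0 <= n)%N -> K x -> P n x = 1.

End Roumieu.

(* Main.v *)
(** Write [D^s] for the derivative along a word [s] of coordinate directions; by
the symmetry of second derivatives all norms can be read on words.

(e) => (b): if (b) fails for the same [r] and some [eps], then adding up functions
[f / T f] with disjoint supports going to infinity gives test functions on which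
the norm stays below [1 / eps] and [T] takes arbitrarily large values.

(b) => (c): split [P n] with a cutoff [chi], equal to [1] near the compact set of
(b). The part at infinity is uniformly small because dilated cutoffs are bounded,
and [f |-> |T (chi f)|] is a continuous seminorm of the space of all
ultradifferentiable functions.

Both (b) and (d) give that, for fixed [C] and [h], [T] is uniformly small on the
test functions supported far away with [|D^s f| <= C h^|s| M_|s|]; for (d) one adds
the counterexamples to every second term of the special unit formed by cutoffs.

From this property to (a): [T (chi_m f)] stabilizes as [m] grows, uniformly on these
balls, which are compact for the convergence of all derivatives, and depends
continuously on [f] there. As in the Banach-Dieudonne theorem, one enlarges the
allowed growth of the derivatives step by step beyond orders [N_1 < N_2 < ...],
keeping [T] bounded; the limit growth is a sequence of the class R.

Cutoffs exist since [sum M_(p-1) / M_p] converges by (M.3): averaging a trapezoid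
successively over intervals of lengths [a_p], proportional to [M_(p-1) / M_p], gives
a function whose [k]-th derivative is at most [2^k / (a_1 ... a_k)]. *)
Require Import Defs.
From mathcomp Require Import all_boot all_order all_algebra.
From mathcomp Require Import all_classical all_reals all_analysis.
From mathcomp Require Import complex ring lra.
Set Implicit Arguments.
Unset Strict Implicit.
Unset Printing Implicit Defensive.
Import Order.TTheory GRing.Theory Num.Theory.
Import numFieldNormedType.Exports.
Local Open Scope classical_set_scope.
Local Open Scope ring_scope.

(** * A non-quasianalytic cutoff on the line *)

Section Averages.
Variable R : realType.
Implicit Types (f g F : R -> R) (x y a : R).

Lemma is_derive_continuous f (df : R -> R) :
  (forall x, is_derive x 1 f (df x)) -> continuous f.
Proof.
move=> h x; apply: differentiable_continuous.
by apply/derivable1_diffP; apply: ex_derive.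
Qed.

Lemma mvt_increment f (df : R -> R) a :
  (forall x, is_derive x 1 f (df x)) -> 0 < a ->
  exists2 t, 0 <= t <= a & f a - f 0 = df t * a.
Proof.
move=> h a0.
have cf : {within `[0, a], continuous f}.
  by apply: continuous_subspaceT; apply: is_derive_continuous h.
have [c cin e] := @MVT_segment R f df 0 a (ltW a0) (fun x _ => h x) cf.
by exists c; [move: cin; rewrite in_itv | rewrite e subr0].
Qed.

Lemma is_derive_translate f (df : R -> R) c x :
  is_derive (c + x) 1 f (df (c + x)) ->
  is_derive x 1 (fun t => f (c + t)) (df (c + x)).
Proof.
move=> h.
have -> : (fun t => f (c + t)) = f \o (shift c).
  by apply/funext => t /=; rewrite addrC.
have h2 : is_derive (shift c x) 1 f (df (c + x)) by rewrite /= addrC.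
have := @is_derive1_comp R f (shift c) x _ _ h2 (is_derive_shift _ _ _).
by rewrite mulr1.
Qed.

(** Vanishing far out makes [f] integrable on the whole line, so the integral from minus infinity is
    a single primitive valid at all points. *)
Lemma continuous_has_primitive f (B : R) : continuous f ->
  (forall x, B < `|x| -> f x = 0) ->
  exists F, forall x, is_derive x 1 F (f x).
Proof.
move=> cf f0; exists (fun x => \int[lebesgue_measure]_(t in [set` Interval -oo%O (BRight x)]) (f t)).
move=> x.
have fi : lebesgue_measure.-integrable setT (EFin \o f).
  have fiB := @continuous_compact_integrable R f _ (@segment_compact R (- B) B) (continuous_subspaceT cf).
  have := (integrable_mkcond _ _).1 fiB; move=> /(_ (measurable_itv _)).
  congr integrable; apply/funext => t; rewrite patchE.
  case: ifPn => // /negP; rewrite inE /= in_itv /= => /negP h.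
  by rewrite f0// ltNge ler_norml.
have [||||h1 h2] := @continuous_FTC1 R f -oo%O x (x + 1).
- by rewrite ltrDl.
- by apply: integrableS fi => //; exact: measurable_itv.
- exact: ltNyr.
- exact: cf.
- by apply: DeriveDef => //; rewrite -derive1E.
Qed.

(** An arbitrary choice, with a default value if no primitive exists; for plateau functions
    [plateau_primitive] provides one. Averages only see its increments. *)
Definition primitive f : R -> R := get [set F | forall x, is_derive x 1 F (f x)].

Definition average a f x := (primitive f (x + a) - primitive f x) / a.

Definition lipschitz1 f := forall x y, `|f x - f y| <= `|x - y|.

Lemma lipschitz1_continuous f : lipschitz1 f -> continuous f.
Proof.
move=> h x; apply/cvgrPdist_le => e e0.
near=> t; apply: (le_trans (h _ _)).
by near: t; apply: cvgr_dist_le.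
Unshelve. all: by end_near. Qed.

(* The plateau [[-4, 4]] of the initial trapezoid loses at most [s], and its
support grows at most by [s], under forward averages of total length [s]. *)
Definition plateau (s : R) f := [/\ lipschitz1 f, forall x, 0 <= f x <= 1,
  forall x, -4 <= x <= 4 - s -> f x = 1 & forall x, f x != 0 -> -5 - s <= x <= 5].

Lemma plateau_primitive s f : plateau s f ->
  forall x, is_derive x 1 (primitive f) (f x).
Proof.
case=> lf _ _ f0.
have [|F hF] := @continuous_has_primitive f (5 + `|s|) (lipschitz1_continuous lf).
  move=> x hx; apply/eqP/negP => /negP/f0 /andP[h1 h2]; move: hx; apply/negP.
  rewrite -leNgt ler_norml; apply/andP; split.
  - by have := ler_norm s; lra.
  - by have := normr_ge0 s; lra.
exact: (@getI _ [set F | forall x, is_derive x 1 F (f x)] F hF).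
Qed.

(** The mean value theorem replaces estimates of integrals: an average is a value of [f] on the
    interval of averaging, so bounds, plateau and support carry over. *)
Lemma average_mvt s f a x : plateau s f -> 0 < a ->
  exists2 t, 0 <= t <= a & average a f x = f (x + t).
Proof.
move=> pf a0; have hF := plateau_primitive pf.
have [|t ht e] := @mvt_increment (fun t => primitive f (x + t)) (fun t => f (x + t)) a _ a0.
  by move=> y; apply: is_derive_translate.
exists t => //; rewrite /average; move: e; rewrite addr0 => ->.
by rewrite mulfK// gt_eqF.
Qed.

(** Applying the mean value theorem to the difference of the two primitives gives the same [t] for
    both functions, so distances between averages are controlled by distances between values. *)
Lemma averageB_mvt s1 s2 f g a x y : plateau s1 f -> plateau s2 g -> 0 < a ->
  exists2 t, 0 <= t <= a & average a f x - average a g y = f (x + t) - g (y + t).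
Proof.
move=> pf pg a0; have hF := plateau_primitive pf; have hG := plateau_primitive pg.
have [|t ht e] := @mvt_increment (fun t => primitive f (x + t) - primitive g (y + t))
  (fun t => f (x + t) - g (y + t)) a _ a0.
  by move=> z; apply: is_deriveB; apply: is_derive_translate.
exists t => //; rewrite /average -mulrBl; move: e; rewrite !addr0 => e.
have -> : primitive f (x + a) - primitive f x - (primitive g (y + a) - primitive g y) =
  primitive f (x + a) - primitive g (y + a) - (primitive f x - primitive g y) by ring.
by rewrite e mulfK// gt_eqF.
Qed.

Lemma is_derive_average s f a x : plateau s f ->
  is_derive x 1 (average a f) ((f (x + a) - f x) / a).
Proof.
move=> pf; have hF := plateau_primitive pf.
have -> : average a f = a^-1 \*: ((fun t => primitive f (a + t)) - primitive f).
  by apply/funext => t; rewrite /average mulrC [t + a]addrC.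
apply: is_derive_eq.
by rewrite add0r mulr1 /GRing.scale /= mulrC (addrC x).
Qed.

Lemma plateau_average s f a : plateau s f -> 0 <= s -> 0 < a ->
  plateau (s + a) (average a f).
Proof.
move=> pf s0 a0; case: (pf) => lf f01 f1 f0; split.
- move=> x y; have [t ht ->] := averageB_mvt x y pf pf a0.
  apply: (le_trans (lf _ _)); rewrite le_eqVlt; apply/orP; left; apply/eqP.
  by congr `| _ |; ring.
- by move=> x; have [t ht ->] := average_mvt x pf a0.
- move=> x hx; have [t ht ->] := average_mvt x pf a0.
  by apply: f1; lra.
- move=> x; have [t ht ->] := average_mvt x pf a0 => /f0; lra.
Qed.

Definition trapezoid x : R := Num.min 1 (Num.max 0 (5 - `|x|)).

Lemma plateau_trapezoid : plateau 0 trapezoid.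
Proof.
have h x : [/\ 0 <= trapezoid x <= 1, (4 < `|x| -> trapezoid x <= 5 - `|x| \/ trapezoid x = 0) & True].
  by split => //; rewrite /trapezoid /Num.min /Num.max; do 2 case: ifPn => //=; rewrite ?lexx ?ler01; lra.
split.
- move=> x y; rewrite /trapezoid /Num.min /Num.max.
  have h1 : `|x| - `|y| <= `|x - y| by apply: lerB_dist.
  have h2 : `|y| - `|x| <= `|x - y| by rewrite distrC; apply: lerB_dist.
  have h3 := normr_ge0 (x - y).
  by rewrite ler_norml; do !case: ifPn => //=; rewrite -?leNgt; lra.
- by move=> x; case: (h x).
- move=> x hx; have h4 : `|x| <= 4 by rewrite ler_norml; lra.
  by rewrite /trapezoid /Num.min /Num.max; do 2 case: ifPn => //=; lra.
- move=> x; rewrite /trapezoid /Num.min /Num.max.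
  have [h5|h5] := leP `|x| 5; first by move: h5; rewrite ler_norml; lra.
  by do 2 case: ifPn => //=; rewrite ?eqxx//; lra.
Qed.

End Averages.

(** * Infinitely many successive averages *)

Section SmoothPlateau.
Variables (R : realType) (a : nat -> R).
Hypotheses (a_gt0 : forall n, 0 < a n)
           (a_sum : forall n, \sum_(0 <= i < n) a i <= 1).

Let S n := \sum_(0 <= i < n) a i.

Let SS n : S n.+1 = S n + a n.
Proof. by rewrite /S big_nat_recr. Qed.

Let S_homo m n : (m <= n)%N -> S m <= S n.
Proof.
move=> /subnK <-; elim: (n - m)%N => [//|k ih].
by rewrite addSn SS; apply: (le_trans ih); rewrite lerDl ltW.
Qed.

Let sigma := sup (range S).

Let has_sup_S : has_sup (range S).
Proof. by split; [exists (S 0), 0%N | exists 1 => _ [n _ <-]; apply: a_sum]. Qed.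

Let tail n := sigma - S n.

Let tail_ge0 n : 0 <= tail n.
Proof. by rewrite subr_ge0; apply: (sup_upper_bound has_sup_S); exists n. Qed.

Let tailS n : tail n = a n + tail n.+1.
Proof. rewrite /tail SS; ring. Qed.

Let tail_small e : 0 < e -> exists N, forall n, (N <= n)%N -> tail n < e.
Proof.
move=> e0; have [_ [N _ <-] h] := sup_adherent e0 has_sup_S.
exists N => n /S_homo h2; rewrite /tail; move: h; rewrite -/sigma; lra.
Qed.

(** The averages have lengths [a k], ..., [a (k + n - 1)], and [a k] is applied last. When [n]
    grows, new averages enter on the inside, next to the trapezoid, so the outer recursion in [k]
    survives the limit. *)
Fixpoint iter_average n k : R -> R :=
  if n is n'.+1 then average (a k) (iter_average n' k.+1) else @trapezoid R.

Let plateau_iter n k : plateau (S (k + n) - S k) (iter_average n k).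
Proof.
elim: n k => [|n ih] k /=; first by rewrite addn0 subrr; apply: plateau_trapezoid.
have := plateau_average (ih k.+1) _ (a_gt0 k).
rewrite addSnnS [S k.+1]SS opprD addrA subrK; apply.
by have := S_homo (leq_addr n k.+1); rewrite addSnnS SS; lra.
Qed.

(** The innermost average moves the 1-Lipschitz trapezoid by at most its length [a (k + n)], and the
    outer averages do not increase the distance. *)
Let iter_step n k x : `|iter_average n.+1 k x - iter_average n k x| <= a (k + n).
Proof.
elim: n k x => [|n ih] k x.
  rewrite /= addn0; have [t ht ->] := average_mvt x (plateau_trapezoid R) (a_gt0 k).
  have [lf _ _ _] := plateau_trapezoid R.
  by apply: (le_trans (lf _ _)); rewrite ler_norml; lra.
rewrite [iter_average n.+2 k]/= [iter_average n.+1 k]/=.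
have [t ht ->] := averageB_mvt x x (plateau_iter n.+1 k.+1) (plateau_iter n k.+1) (a_gt0 k).
by rewrite -addSnnS; apply: ih.
Qed.

(** The pointwise limit in [n]: adding the tail makes the sequence decreasing by [iter_mono], so the
    limit is an infimum. *)
Definition limit_average k x : R :=
  inf (range (fun n => iter_average n k x + tail (k + n))).

Let iter_mono n m k x : (n <= m)%N ->
  iter_average m k x + tail (k + m) <= iter_average n k x + tail (k + n) /\
  iter_average n k x - tail (k + n) <= iter_average m k x - tail (k + m).
Proof.
move=> /subnK <-; elim: (m - n)%N => [//|j [ih1 ih2]].
have := iter_step (j + n) k x; rewrite ler_norml addSn addnS.
have := tailS (k + (j + n)); lra.
Qed.

Let limit_average_dist n k x :
  `|limit_average k x - iter_average n k x| <= tail (k + n).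
Proof.
have lb y : (forall m, y <= iter_average m k x + tail (k + m)) -> y <= limit_average k x.
  by move=> h; apply: lb_le_inf; [exists (iter_average 0 k x + tail (k + 0)), 0%N | move=> _ [m _ <-]].
have : iter_average n k x - tail (k + n) <= limit_average k x.
  apply: lb => m; case/orP: (leq_total n m) => nm.
  - by have [_] := iter_mono k x nm; have := tail_ge0 (k + m); lra.
  - by have [+ _] := iter_mono k x nm; have := tail_ge0 (k + n); lra.
have : limit_average k x <= iter_average n k x + tail (k + n).
  apply: ge_inf; last by exists n.
  exists (0 - 0) => _ [m _ <-]; have [_ + _ _] := plateau_iter m k.
  by move=> /(_ x) /andP[? _]; have := tail_ge0 (k + m); lra.
by rewrite ler_norml; lra.
Qed.

Let limit_approx e k : 0 < e ->
  exists N, forall n x, (N <= n)%N -> `|limit_average k x - iter_average n k x| < e.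
Proof.
move=> e0; have [N hN] := tail_small e0; exists N => n x Nn.
by apply: le_lt_trans (limit_average_dist n k x) (hN _ _); rewrite (leq_trans Nn)// leq_addl.
Qed.

Let S_le1 n k : 0 <= S (k + n) - S k <= 1.
Proof.
have := S_homo (leq_addr n k); have := a_sum (k + n).
have := S_homo (leq0n k); rewrite {1}/S big_geq// -/(S _); lra.
Qed.

Lemma plateau_limit_average k : plateau 1 (limit_average k).
Proof.
split.
- move=> x y; apply/ler_addgt0Pr => e e0.
  have e20 : 0 < e / 2 by lra.
  have [N /(_ N)h] := limit_approx k e20; have hx := h x (leqnn _); have hy := h y (leqnn _).
  have [/(_ x y) + _ _ _] := plateau_iter N k; move: hx hy.
  rewrite !ltr_norml => hx hy; move: `|x - y| => D; rewrite !ler_norml; lra.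
- move=> x; apply/andP; split; apply/ler_addgt0Pr => e e0;
  have [N /(_ N x (leqnn _))] := limit_approx k e0;
  have [_ /(_ x) + _ _] := plateau_iter N k; rewrite !ltr_norml; lra.
- move=> x hx; apply/eqP; rewrite -subr_eq0 -normr_le0; apply/ler_addgt0Pr => e e0.
  have [N /(_ N x (leqnn _))] := limit_approx k e0.
  have [_ _ /(_ x) + _] := plateau_iter N k => ->; first by rewrite add0r => /ltW.
  by have := S_le1 N k; lra.
- move=> x; apply: contraNT => hx.
  rewrite -normr_le0; apply/ler_addgt0Pr => e e0.
  have [N /(_ N x (leqnn _))] := limit_approx k e0.
  have [_ _ _ /(_ x) h] := plateau_iter N k.
  have [->|/h h2] := eqVneq (iter_average N k x) 0; first by rewrite subr0 add0r => /ltW.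
  by exfalso; move/negP: hx; apply; have := S_le1 N k; lra.
Qed.

(** The recursion passes to the uniform limit. With [is_derive_average], the derivative of
    [limit_average k] becomes a difference quotient of [limit_average k.+1] with step [a k]. *)
Lemma limit_averageE k x : limit_average k x = average (a k) (limit_average k.+1) x.
Proof.
apply/eqP; rewrite -subr_eq0 -normr_le0; apply/ler_addgt0Pr => e e0.
have e20 : 0 < e / 2 by lra.
have [N hN] := limit_approx k e20.
have [N' hN'] := limit_approx k.+1 e20.
have := hN (maxn N N').+1 x (leq_trans (leq_maxl _ _) (leqnSn _)).
have [t ht] := averageB_mvt x x (plateau_limit_average k.+1) (plateau_iter (maxn N N') k.+1) (a_gt0 k).
have := hN' (maxn N N') (x + t) (leq_maxr _ _).
rewrite [iter_average _.+1 k]/=.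
rewrite !ltr_norml ler_norml; lra.
Qed.

(** Iterated difference quotients with steps [a 0], ..., [a (k - 1)]: by [limit_averageE] the [k]-th
    derivative of [limit_average 0] is [iter_slope k (limit_average k)]. *)
Fixpoint iter_slope k (f : R -> R) : R -> R :=
  if k is k'.+1 then iter_slope k' (fun x => (f (x + a k') - f x) / a k') else f.

Lemma is_derive_iter_slope k (f df : R -> R) :
  (forall x : R, is_derive x 1 f (df x)) ->
  forall x : R, is_derive x 1 (iter_slope k f) (iter_slope k df x).
Proof.
elim: k f df => [//|k ih] f df h x /=; apply: ih => {}x.
have -> : (fun x => (f (x + a k) - f x) / a k) = (a k)^-1 \*: ((fun t => f (a k + t)) - f).
  by apply/funext => t; rewrite mulrC [t + a k]addrC.
apply: is_derive_eq.
by rewrite add0r mulr1 /GRing.scale /= mulrC (addrC x).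
Qed.

Lemma iter_slope_bound k f (B : R) : (forall x, `|f x| <= B) ->
  forall x, `|iter_slope k f x| <= B * \prod_(0 <= j < k) (2 / a j).
Proof.
elim: k f B => [|k ih] f B h x /=; first by rewrite big_geq// mulr1.
rewrite big_nat_recr//=.
have -> : B * (\prod_(0 <= j < k) (2 / a j) * (2 / a k)) =
  (2 * B / a k) * \prod_(0 <= j < k) (2 / a j) by ring.
apply: ih => y; rewrite normrM normfV (gtr0_norm (a_gt0 k)).
apply: ler_wpM2r; first by rewrite invr_ge0 ltW.
by apply: (le_trans (ler_normB _ _)); have := h y; have := h (y + a k); lra.
Qed.

Lemma smooth_plateau_exists : exists v : nat -> R -> R,
  [/\ forall k (x : R), is_derive x 1 (v k) (v k.+1 x),
      forall k x, `|v k x| <= \prod_(0 <= j < k) (2 / a j),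
      forall x, `|x| <= 2 -> v 0 x = 1 & forall x, 6 < `|x| -> v 0 x = 0].
Proof.
exists (fun k => iter_slope k (limit_average k)); split.
- move=> k x; apply: is_derive_iter_slope => {}x.
  have -> : limit_average k = average (a k) (limit_average k.+1).
    by apply/funext => y; exact: limit_averageE.
  exact: is_derive_average (plateau_limit_average k.+1).
- move=> k x; rewrite -[leRHS]mul1r; apply: iter_slope_bound => {}x.
  have [_ /(_ x) /andP[h1 h2] _ _] := plateau_limit_average k.
  by rewrite ger0_norm.
- move=> x; rewrite ler_norml => hx /=; have [_ _ -> //] := plateau_limit_average 0.
  by lra.
- move=> x hx /=; have [_ _ _ h] := plateau_limit_average 0.
  apply/eqP; apply: contraLR hx => /h h1; rewrite -leNgt ler_norml; lra.
Qed.

End SmoothPlateau.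

Lemma cutoff1_exists (R : realType) (M : nat -> R) (A : R) :
  (forall p, 0 < M p) -> M 0 = 1 -> M3 A M ->
  exists H (v : nat -> R -> R), [/\ 1 <= H,
   forall k (x : R), is_derive x 1 (v k) (v k.+1 x),
   forall k x, `|v k x| <= H ^+ k * M k,
   forall x, `|x| <= 2 -> v 0 x = 1 & forall x, 6 < `|x| -> v 0 x = 0].
Proof.
move=> M_gt0 M01 /(_ 1%N isT) hM.
(* (M.3) with [q = 1] bounds the sum of [M p.-1 / M p] from [p = 2] on; the term [p = 1] is added by
   hand. *)
pose L := A * 1 * M 1 / M 2 + M 0 / M 1.
have q_gt0 j : 0 < M j / M j.+1 by apply: divr_gt0.
have hL n : \sum_(0 <= j < n) (M j / M j.+1) <= L.
  have hn : \sum_(0 <= j < n.+1) (M j / M j.+1) <= L.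
    rewrite big_nat_recl// /L addrC lerD2r.
    have := le_trans (@nneseries_lim_ge R (fun p => (M p.-1 / M p)%:E) xpredT 2 n.+2 _) hM.
    rewrite sumEFin lee_fin => h; apply: le_trans (h _).
    - rewrite (@big_addn _ _ _ 0 n.+2 2) subSS subSS subn0.
      by apply: ler_sum => i _; rewrite !addn2.
    - by move=> p _ _; rewrite lee_fin divr_ge0// ltW.
  by apply: le_trans hn; rewrite big_nat_recr//= lerDl ltW.
have L0 : 0 < L.
  by apply: lt_le_trans (hL 1%N); rewrite big_nat1.
(* The lengths [c * (M j / M j.+1)] have total at most 1, and the product of the [2 / a j]
   telescopes to [(2 / c) ^+ k * M k]. *)
pose c := (L + 1)^-1.
have c0 : 0 < c by rewrite invr_gt0; lra.
have [||v [v1 v2 v3 v4]] := @smooth_plateau_exists R (fun j => c * (M j / M j.+1)).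
- by move=> n; apply: mulr_gt0.
- move=> n; rewrite -mulr_sumr /c mulrC ler_pdivrMr; last by lra.
  by have := hL n; lra.
exists (2 / c), v; split => //.
- by rewrite /c invrK; lra.
- move=> k x; apply: (le_trans (v2 k x)); rewrite le_eqVlt; apply/orP; left; apply/eqP.
  elim: k => [|k ih]; first by rewrite big_geq// expr0 M01 mulr1.
  rewrite big_nat_recr//= ih exprS; field.
  by rewrite !gt_eqF.
Qed.

(** * Directional derivatives *)

Section DirectionalDerivatives.
Variables (R : realType) (V : normedModType R).
Implicit Types (h : V -> R) (x v w : V) (t l L : R).

Lemma is_derive_lineE h x v t l :
  is_derive (x + t *: v) v h l <-> is_derive t (1 : R) (fun s => h (x + s *: v)) l.
Proof.
have E : (fun s : R => s^-1 *: (((fun s => h (x + s *: v)) \o shift t) (s *: (1 : R)) - h (x + t *: v)))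
  = (fun s => s^-1 *: ((h \o shift (x + t *: v)) (s *: v) - h (x + t *: v))).
  apply/funext => s /=; congr (_ *: (h _ - _)).
  by rewrite scalerDl [s *: (1 : R)]mulr1 addrCA.
by split=> -[h1 h2]; split; move: h1 h2; rewrite /derivable /derive /= E.
Qed.

Lemma mean_value (f df : R -> R) t : (forall s : R, is_derive s (1 : R) f (df s)) ->
  exists2 s, `|s| <= `|t| & f t - f 0 = df s * t.
Proof.
move=> hf; have cf := is_derive_continuous hf.
have [t0|/ltW t0] := leP 0 t.
  have [c] := @MVT_segment R f df 0 t t0 (fun u _ => hf u) (continuous_subspaceT cf).
  rewrite in_itv /= => /andP[c0 ct] e; exists c; last by rewrite e subr0.
  by rewrite !ger0_norm.
have [c] := @MVT_segment R f df t 0 t0 (fun u _ => hf u) (continuous_subspaceT cf).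
rewrite in_itv /= => /andP[c0 ct] e; exists c; last by move: e; rewrite sub0r; lra.
by rewrite !ler0_norm// lerN2.
Qed.

Lemma mean_value_line h h' x v t : (forall y, is_derive y v h (h' y)) ->
  exists2 s, `|s| <= `|t| & h (x + t *: v) - h x = h' (x + s *: v) * t.
Proof.
move=> hh; have [s st e] := @mean_value (fun s => h (x + s *: v)) (fun s => h' (x + s *: v)) t
  (fun s => (is_derive_lineE h x v s _).1 (hh _)).
by exists s => //; move: e; rewrite scale0r addr0.
Qed.

Lemma is_derive_of_quadratic h x v l L :
  (forall t, `|h (x + t *: v) - h x - t * l| <= L * t ^+ 2) -> is_derive x v h l.
Proof.
move=> hL.
have L0 : 0 <= L by have := le_trans (normr_ge0 _) (hL 1); rewrite expr1n mulr1.
have H : ((fun s => s^-1 *: ((h \o shift x) (s *: v) - h x)) @ 0^') --> l.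
  apply/cvgrPdist_le => e e0; near=> t.
  have t0 : t != 0 by near: t; exact: nbhs_dnbhs_neq.
  rewrite /= (addrC _ x).
  have -> : l - t^-1 *: (h (x + t *: v) - h x) = - (t^-1 * (h (x + t *: v) - h x - t * l)).
    by rewrite mulrBr [t^-1 * (t * l)]mulrA mulVf// mul1r opprB.
  rewrite normrN normrM normfV ler_pdivrMl ?normr_gt0//.
  apply: le_trans (hL t) _; rewrite -real_normK ?num_real// expr2 mulrA mulrC.
  apply: ler_wpM2l => //.
  have te : `|t| <= e / (L + 1).
    near: t; apply: dnbhs0_le; apply: divr_gt0 => //; lra.
  have : (L + 1) * `|t| <= e by rewrite mulrC -ler_pdivlMr//; lra.
  by have := normr_ge0 t; lra.
by split; [apply: cvgP H | apply: cvg_lim H].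
Unshelve. all: by end_near. Qed.

Lemma taylor_quadratic h h' h'' x v L t :
  (forall y, is_derive y v h (h' y)) -> (forall y, is_derive y v h' (h'' y)) ->
  (forall y, `|h'' y| <= L) -> `|h (x + t *: v) - h x - t * h' x| <= L * t ^+ 2.
Proof.
move=> d1 d2 b.
have [s st ->] := mean_value_line x t d1.
have -> : h' (x + s *: v) * t - t * h' x = t * (h' (x + s *: v) - h' x) by ring.
have [r rs ->] := mean_value_line x s d2.
rewrite -real_normK ?num_real// !normrM mulrCA expr2.
apply: le_trans (_ : L * (`|t| * `|s|) <= _).
  by apply: ler_wpM2r => //; exact: mulr_ge0.
apply: ler_wpM2l; first exact: le_trans (b x).
by apply: ler_wpM2l.
Qed.

(** The bound on second derivatives gives a quadratic Taylor remainder with a constant independent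
    of [n]. Such an inequality survives pointwise limits, and it implies differentiability of the
    limit. *)
Lemma is_derive_ultralimit (F : set_system nat) (FF : ProperFilter F)
    (hn h'n h''n : nat -> V -> R) h h' v L :
  (forall n y, is_derive y v (hn n) (h'n n y)) ->
  (forall n y, is_derive y v (h'n n) (h''n n y)) ->
  (forall n y, `|h''n n y| <= L) ->
  (forall y, hn ^~ y @ F --> h y) -> (forall y, h'n ^~ y @ F --> h' y) ->
  forall y, is_derive y v h (h' y).
Proof.
move=> d1 d2 b c1 c2 y; apply: (@is_derive_of_quadratic _ _ _ _ L) => t.
apply: (@closed_cvg _ _ F FF (fun n => `|hn n (y + t *: v) - hn n y - t * h'n n y|)
  [set z | z <= L * t ^+ 2]).
- exact: closed_le.
- by apply: nearW => n /=; apply: taylor_quadratic.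
- apply: cvg_norm; apply: cvgB; first by apply: cvgB.
  by apply: cvgM => //; exact: cvg_cst.
Qed.

(** Both sides, multiplied by [t ^+ 2], are the second difference of [h] over the parallelogram
    spanned by [t *: v] and [t *: w]; the mean value theorem is applied twice in each of the two
    orders. *)
Lemma mixed_derivatives_near h (hi hj hij hji : V -> R) x v w :
  (forall y, is_derive y v h (hi y)) -> (forall y, is_derive y w h (hj y)) ->
  (forall y, is_derive y w hi (hij y)) -> (forall y, is_derive y v hj (hji y)) ->
  forall t, 0 < t -> exists s1 r1 s2 r2,
   [/\ `|s1| <= t, `|r1| <= t, `|s2| <= t, `|r2| <= t &
    hij (x + s1 *: v + r1 *: w) = hji (x + s2 *: v + r2 *: w)].
Proof.
move=> dv dw dvw dwv t t0.
have [|s1 b1 e1] := @mean_value (fun s => h (x + s *: v + t *: w) - h (x + s *: v))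
   (fun s => hi (x + s *: v + t *: w) - hi (x + s *: v)) t _.
  move=> s; apply: is_deriveB; last by apply/is_derive_lineE.
  have -> : (fun s => h (x + s *: v + t *: w)) = (fun s => h ((x + t *: w) + s *: v)).
    by apply/funext => z; rewrite addrAC.
  by apply/is_derive_lineE; rewrite addrAC; apply: dv.
have [|r2 b2 e2] := @mean_value (fun s => h (x + s *: w + t *: v) - h (x + s *: w))
   (fun s => hj (x + s *: w + t *: v) - hj (x + s *: w)) t _.
  move=> s; apply: is_deriveB; last by apply/is_derive_lineE.
  have -> : (fun s => h (x + s *: w + t *: v)) = (fun s => h ((x + t *: v) + s *: w)).
    by apply/funext => z; rewrite addrAC.
  by apply/is_derive_lineE; rewrite addrAC; apply: dw.
have [r1 b3 e3] := mean_value_line (x + s1 *: v) t dvw.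
have [s2 b4 e4] := mean_value_line (x + r2 *: w) t dwv.
exists s1, r1, s2, r2; rewrite !(gtr0_norm t0) in b1 b2 b3 b4; split => //.
rewrite [x + s2 *: v + _]addrAC.
move: e1 e2; rewrite !scale0r !addr0 e3 e4 [x + t *: w + t *: v]addrAC => e1 e2.
have tn : t != 0 by rewrite gt_eqF.
apply: (mulIf tn); apply: (mulIf tn); rewrite -e1 -e2; ring.
Qed.

Lemma schwarz_symmetry h (hi hj hij hji : V -> R) x v w :
  (forall y, is_derive y v h (hi y)) -> (forall y, is_derive y w h (hj y)) ->
  (forall y, is_derive y w hi (hij y)) -> (forall y, is_derive y v hj (hji y)) ->
  continuous hij -> continuous hji -> hij x = hji x.
Proof.
move=> dv dw dvw dwv c1 c2.
apply/eqP; rewrite -subr_eq0 -normr_le0; apply/ler_addgt0Pr => e e0; rewrite add0r.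
have e20 : 0 < e / 2 by lra.
have /cvgrPdist_le /(_ _ e20) /nbhs_ballP[d1 /= d10 h1] := c1 x.
have /cvgrPdist_le /(_ _ e20) /nbhs_ballP[d2 /= d20 h2] := c2 x.
pose N := `|v| + `|w| + 1.
have N0 : 0 < N by rewrite /N; have := normr_ge0 v; have := normr_ge0 w; lra.
(* With this [t] all intermediate points stay within both radii of continuity around [x]. *)
pose t := Num.min d1 d2 / (2 * N).
have t0 : 0 < t by rewrite divr_gt0 ?mulr_gt0// lt_min d10.
have tN : N * t < Num.min d1 d2.
  rewrite /t; have -> : N * (Num.min d1 d2 / (2 * N)) = Num.min d1 d2 / 2 by field; rewrite gt_eqF.
  have : 0 < Num.min d1 d2 by rewrite lt_min d10.
  lra.
have [s1 [r1 [s2 [r2 [b1 b2 b3 b4 E]]]]] := mixed_derivatives_near x dv dw dvw dwv t0.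
have near s r : `|s| <= t -> `|r| <= t -> `|x - (x + s *: v + r *: w)| < Num.min d1 d2.
  move=> hs hr; apply: le_lt_trans tN.
  rewrite -addrA opprD addrA subrr add0r normrN.
  apply: le_trans (ler_normD _ _) _; rewrite !normrZ.
  have : `|s| * `|v| <= t * `|v| by apply: ler_wpM2r.
  have : `|r| * `|w| <= t * `|w| by apply: ler_wpM2r.
  rewrite /N; have := ltW t0; lra.
have n1 := h1 (x + s1 *: v + r1 *: w).
have n2 := h2 (x + s2 *: v + r2 *: w).
have m1 : `|hij x - hij (x + s1 *: v + r1 *: w)| <= e / 2.
  by apply: n1; rewrite -ball_normE /=; have := near s1 r1 b1 b2; rewrite lt_min => /andP[].
have m2 : `|hji x - hji (x + s2 *: v + r2 *: w)| <= e / 2.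
  by apply: n2; rewrite -ball_normE /=; have := near s2 r2 b3 b4; rewrite lt_min => /andP[].
move: m1 m2; rewrite E !ler_norml; lra.
Qed.

End DirectionalDerivatives.

(** * Lipschitz bounds from bounds on partial derivatives *)

Section PartialLipschitz.
Variables (R : realType) (d : nat).
Implicit Types (h : 'rV[R]_d -> R) (x y : 'rV[R]_d).

Lemma coord_le_norm x (j : 'I_d) : `|x 0 j| <= `|x|.
Proof.
rewrite [leRHS]/Num.norm /= mx_normrE.
by apply: (le_trans _ (@le_bigmax _ _ _ 0 (fun i => `|x i.1 i.2|) (0, j))).
Qed.

Lemma norm_leP x (c : R) : 0 <= c -> (forall j, `|x 0 j| <= c) -> `|x| <= c.
Proof.
move=> c0 hc; rewrite [leLHS]/Num.norm /= mx_normrE; apply: bigmax_le => // -[i j] _ /=.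
by rewrite ord1.
Qed.

Lemma partial_bound_lipschitz h (hj : 'I_d -> 'rV[R]_d -> R) (L : R) :
  (forall j x, is_derive x (delta_mx 0 j) h (hj j x)) ->
  (forall j x, `|hj j x| <= L) -> forall x y, `|h x - h y| <= d%:R * L * `|x - y|.
Proof.
move=> dh bh x y.
(* The path from [y] to [x] changes one coordinate at a time: [z m] has the first [m] coordinates of
   [x] and the others of [y]. *)
pose z m := \row_j (if (j < m)%N then x 0 j else y 0 j).
have step m : (m <= d)%N -> `|h (z m) - h y| <= m%:R * L * `|x - y|.
  elim: m => [_|m ih md].
    have -> : z 0%N = y by apply/rowP => j; rewrite mxE.
    by rewrite subrr normr0 !mul0r.
  have -> : z m.+1 = z m + (x - y) 0 (Ordinal md) *: delta_mx 0 (Ordinal md).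
    apply/rowP => j; rewrite !mxE eqxx /= ltnS leq_eqVlt -[j == Ordinal md]val_eqE /=.
    have [e|ne] := eqVneq (j : nat) m.
      have -> : j = Ordinal md by apply/val_inj.
      by rewrite /= ltnn mulr1 addrCA subrr addr0.
    by rewrite /= mulr0 addr0.
  have [s _ e] := mean_value_line (z m) ((x - y) 0 (Ordinal md)) (dh (Ordinal md)).
  have -> (a : R) : a - h y = (a - h (z m)) + (h (z m) - h y) by ring.
  rewrite e; apply: le_trans (ler_normD _ _) _.
  rewrite -natr1 mulrDl mul1r mulrDl [leRHS]addrC; apply: lerD; last exact: ih (ltnW md).
  rewrite normrM; apply: ler_pM => //; exact: coord_le_norm.
have := step d (leqnn d); congr (`|h _ - _| <= _).
by apply/rowP => j; rewrite mxE ltn_ord.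
Qed.

End PartialLipschitz.

(** * Iterated partial derivatives of complex functions *)

Section ComplexModulus.
Variable R : realType.
Implicit Types z : R[i].

Lemma ReD z1 z2 : complex.Re (z1 + z2) = complex.Re z1 + complex.Re z2.
Proof. by case: z1 => ? ?; case: z2. Qed.
Lemma ImD z1 z2 : complex.Im (z1 + z2) = complex.Im z1 + complex.Im z2.
Proof. by case: z1 => ? ?; case: z2. Qed.
Lemma ReN z : complex.Re (- z) = - complex.Re z.
Proof. by case: z. Qed.
Lemma ImN z : complex.Im (- z) = - complex.Im z.
Proof. by case: z. Qed.
Lemma ReM z1 z2 : complex.Re (z1 * z2) =
  complex.Re z1 * complex.Re z2 - complex.Im z1 * complex.Im z2.
Proof. by case: z1 => ? ?; case: z2. Qed.
Lemma ImM z1 z2 : complex.Im (z1 * z2) =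
  complex.Re z1 * complex.Im z2 + complex.Im z1 * complex.Re z2.
Proof. by case: z1 => ? ?; case: z2. Qed.

Lemma complex_ext z1 z2 : complex.Re z1 = complex.Re z2 ->
  complex.Im z1 = complex.Im z2 -> z1 = z2.
Proof. by case: z1 => ? ?; case: z2 => ? ? /= -> ->. Qed.

Lemma cmod_ge0 z : 0 <= cmod z.
Proof. by case: z => a b; exact: sqrtr_ge0. Qed.

Lemma cmodD z1 z2 : cmod (z1 + z2) <= cmod z1 + cmod z2.
Proof. exact: le_normcD. Qed.

Lemma cmodN z : cmod (- z) = cmod z.
Proof. by case: z => a b /=; rewrite !sqrrN. Qed.

Lemma cmodB z1 z2 : cmod (z1 - z2) <= cmod z1 + cmod z2.
Proof. by rewrite -[cmod z2]cmodN cmodD. Qed.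

Lemma Re_le_cmod z : `|complex.Re z| <= cmod z.
Proof.
case: z => a b /=; rewrite -sqrtr_sqr; apply: ler_wsqrtr.
by rewrite lerDl sqr_ge0.
Qed.

Lemma Im_le_cmod z : `|complex.Im z| <= cmod z.
Proof.
case: z => a b /=; rewrite -sqrtr_sqr; apply: ler_wsqrtr.
by rewrite lerDr sqr_ge0.
Qed.

Lemma cmod_le_ReIm z : cmod z <= `|complex.Re z| + `|complex.Im z|.
Proof.
case: z => a b /=; have h := addr_ge0 (normr_ge0 a) (normr_ge0 b).
rewrite -[leRHS]ger0_norm// -sqrtr_sqr; apply: ler_wsqrtr.
rewrite sqrrD !real_normK ?num_real// -addrA lerD2l lerDr.
by rewrite mulrn_wge0// mulr_ge0.
Qed.

Lemma cmod_real (a : R) : cmod (a +i* 0)%C = `|a|.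
Proof. by rewrite /= expr0n addr0 sqrtr_sqr. Qed.

Lemma cmod_eq0 z : cmod z <= 0 -> z = 0.
Proof.
move=> h; apply: ComplexField.Normc.eq0_normc.
by apply/eqP; rewrite eq_le h cmod_ge0.
Qed.

End ComplexModulus.

(** * Derivatives along words: Leibniz rule, locality and symmetry *)

Section Words.
Variables (R : realType) (d : nat).
Implicit Types (f g : cfun R d) (s t : seq 'I_d) (j : 'I_d).

Definition ccont f := continuous (re_part f) /\ continuous (im_part f).

Definition has_partial j f g := forall x,
  is_derive x (delta_mx 0 j) (re_part f) (re_part g x) /\
  is_derive x (delta_mx 0 j) (im_part f) (im_part g x).

Definition wD s f : cfun R d := foldr (@partial R d) f s.

Lemma has_partialE j f g : has_partial j f g -> partial j f = g.
Proof.
move=> h; apply/funext => x; have [[_ h1] [_ h2]] := h x.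
by rewrite /partial h1 h2 /re_part /im_part; case: (g x).
Qed.

(** Smoothness concerns all iterated derivatives at once. Given candidates [F s] for every word,
    linked by one partial derivative at each letter, induction on the word yields smoothness
    together with the formula for the derivatives. *)
Lemma smooth_family (F : seq 'I_d -> cfun R d) :
  (forall s, ccont (F s)) -> (forall s j, has_partial j (F s) (F (j :: s))) ->
  smooth (F [::]) /\ forall s, wD s (F [::]) = F s.
Proof.
move=> cF dF.
have E s : wD s (F [::]) = F s.
  by elim: s => [//|j s ih] /=; rewrite -(has_partialE (dF s j)) -ih.
split=> // s; rewrite -/(wD s (F [::])) E; split; [exact: (cF s).1|exact: (cF s).2|].
by move=> j x; have [[h1 _] [h2 _]] := dF s j x.
Qed.

Lemma smooth_ccont f s : smooth f -> ccont (wD s f).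
Proof. by move=> /(_ s)[]. Qed.

Lemma smooth_has_partial f s j : smooth f -> has_partial j (wD s f) (wD (j :: s) f).
Proof.
move=> /(_ s)[_ _ h] x; have [h1 h2] := h j x.
by split; split.
Qed.

Lemma smooth_wD f t : smooth f -> smooth (wD t f).
Proof. by move=> h s; have := h (s ++ t); rewrite foldr_cat. Qed.

Lemma ccontD f g : ccont f -> ccont g -> ccont (fun x => f x + g x).
Proof.
move=> [f1 f2] [g1 g2]; split=> x.
- rewrite /re_part (_ : (fun _ => _) = fun x => re_part f x + re_part g x); last first.
    by apply/funext => y; rewrite ReD.
  exact: (continuousD (f1 x) (g1 x)).
- rewrite /im_part (_ : (fun _ => _) = fun x => im_part f x + im_part g x); last first.
    by apply/funext => y; rewrite ImD.
  exact: (continuousD (f2 x) (g2 x)).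
Qed.

Definition cmul f g : cfun R d := fun x => f x * g x.

Lemma ccontM f g : ccont f -> ccont g -> ccont (cmul f g).
Proof.
move=> [f1 f2] [g1 g2]; split=> x.
- rewrite /re_part (_ : (fun _ => _) = fun x => re_part f x * re_part g x - im_part f x * im_part g x); last first.
    by apply/funext => y; rewrite ReM.
  exact: (continuousB (continuousM (f1 x) (g1 x)) (continuousM (f2 x) (g2 x))).
- rewrite /im_part (_ : (fun _ => _) = fun x => re_part f x * im_part g x + im_part f x * re_part g x); last first.
    by apply/funext => y; rewrite ImM.
  exact: (continuousD (continuousM (f1 x) (g2 x)) (continuousM (f2 x) (g1 x))).
Qed.

Lemma ccont_cst (c : R[i]) : ccont (fun=> c).
Proof. by split; exact: cst_continuous. Qed.

Lemma has_partialD j f g f' g' : has_partial j f f' -> has_partial j g g' ->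
  has_partial j (fun x => f x + g x) (fun x => f' x + g' x).
Proof.
move=> hf hg x; have [f1 f2] := hf x; have [g1 g2] := hg x; split.
- rewrite /re_part (_ : (fun _ => _) = re_part f + re_part g); last first.
    by apply/funext => y; rewrite ReD.
  by rewrite ReD; apply: is_deriveD.
- rewrite /im_part (_ : (fun _ => _) = im_part f + im_part g); last first.
    by apply/funext => y; rewrite ImD.
  by rewrite ImD; apply: is_deriveD.
Qed.

Lemma has_partialM j f g f' g' : has_partial j f f' -> has_partial j g g' ->
  has_partial j (cmul f g) (fun x => f' x * g x + f x * g' x).
Proof.
move=> hf hg x; have [f1 f2] := hf x; have [g1 g2] := hg x; split.
- rewrite /re_part (_ : (fun _ => _) = re_part f * re_part g - im_part f * im_part g); last first.
    by apply/funext => y; rewrite ReM.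
  by apply: is_derive_eq; rewrite ReD !ReM /GRing.scale /= /re_part /im_part; ring.
- rewrite /im_part (_ : (fun _ => _) = re_part f * im_part g + im_part f * re_part g); last first.
    by apply/funext => y; rewrite ImM.
  by apply: is_derive_eq; rewrite ImD !ImM /GRing.scale /= /re_part /im_part; ring.
Qed.

Lemma has_partial_cst j (c : R[i]) : has_partial j (fun=> c) (fun=> 0).
Proof. by move=> x; split; exact: is_derive_cst. Qed.

Lemma smooth_cst (c : R[i]) : smooth ((fun=> c) : cfun R d).
Proof.
pose F s : cfun R d := fun=> if s is [::] then c else 0.
have [] // := @smooth_family F.
- by move=> s; exact: ccont_cst.
- by move=> s j; exact: has_partial_cst.
Qed.

Lemma wD_cst (c : R[i]) s : wD s (fun=> c) = fun=> if s is [::] then c else 0.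
Proof.
pose F s : cfun R d := fun=> if s is [::] then c else 0.
have [] // := @smooth_family F.
- by move=> {}s; exact: ccont_cst.
- by move=> {}s j; exact: has_partial_cst.
Qed.

Lemma smooth_lin (a : R[i]) f g : smooth f -> smooth g ->
  smooth (a *: f + g) /\ forall s, wD s (a *: f + g) = a *: wD s f + wD s g.
Proof.
move=> sf sg; pose F s : cfun R d := a *: wD s f + wD s g.
apply: (@smooth_family F) => [s|s j].
- by apply: ccontD (smooth_ccont s sg); apply: ccontM (ccont_cst _) (smooth_ccont s sf).
- have h := has_partialM (has_partial_cst j a) (smooth_has_partial s j sf).
  have := has_partialD h (smooth_has_partial s j sg).
  rewrite (_ : (fun x => 0 * wD s f x + a * wD (j :: s) f x + wD (j :: s) g x) = F (j :: s))//.
  by apply/funext => x; rewrite mul0r add0r.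
Qed.

Lemma wD0 s : wD s (0 : cfun R d) = 0.
Proof. by rewrite (wD_cst 0); apply/funext => x; case: s. Qed.

Lemma smoothZ (a : R[i]) f : smooth f -> smooth (a *: f).
Proof. by move=> sf; rewrite -[_ *: _]addr0; apply: (smooth_lin _ sf (smooth_cst 0)).1. Qed.

Lemma wDZ (a : R[i]) f s : smooth f -> wD s (a *: f) = a *: wD s f.
Proof.
move=> sf; rewrite -[a *: f]addr0 (smooth_lin _ sf (smooth_cst 0)).2.
by rewrite (wD0 s) addr0.
Qed.

Lemma smoothD f g : smooth f -> smooth g -> smooth (f + g).
Proof. by move=> sf sg; rewrite -[f]scale1r; apply: (smooth_lin _ sf sg).1. Qed.

Lemma wDD f g s : smooth f -> smooth g -> wD s (f + g) = wD s f + wD s g.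
Proof.
by move=> sf sg; rewrite -{1}[f]scale1r (smooth_lin _ sf sg).2 scale1r.
Qed.

Lemma smoothB f g : smooth f -> smooth g -> smooth (f - g).
Proof. by move=> sf sg; rewrite -scaleN1r; apply: smoothD => //; apply: smoothZ. Qed.

Lemma wDB f g s : smooth f -> smooth g -> wD s (f - g) = wD s f - wD s g.
Proof.
move=> sf sg; have sg' := smoothZ (-1) sg.
by rewrite -scaleN1r (wDD s sf sg') (wDZ _ _ sg) scaleN1r.
Qed.

(** All ways of distributing the letters of a word over two subwords, listed with repetitions, so
    that the Leibniz rule has no binomial coefficients but [2 ^ size s] terms. *)
Fixpoint splittings s : seq (seq 'I_d * seq 'I_d) :=
  if s is j :: s' then
    [seq (j :: p.1, p.2) | p <- splittings s'] ++ [seq (p.1, j :: p.2) | p <- splittings s']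
  else [:: ([::], [::])].

Lemma size_splittings s : size (splittings s) = (2 ^ size s)%N.
Proof.
elim: s => [//|j s ih] /=; rewrite size_cat !size_map ih expnS.
by rewrite mulSn mul1n.
Qed.

Lemma mem_splittings s p : p \in splittings s -> (size p.1 + size p.2)%N = size s.
Proof.
elim: s p => [|j s ih] p /=; first by rewrite inE => /eqP ->.
by rewrite mem_cat => /orP[] /mapP[q /ih <- ->] /=; rewrite ?addSn ?addnS.
Qed.

Let leibniz f g (L : seq (seq 'I_d * seq 'I_d)) : cfun R d :=
  fun x => \sum_(p <- L) wD p.1 f x * wD p.2 g x.

Let leibniz_cons f g p L :
  leibniz f g (p :: L) = fun x => cmul (wD p.1 f) (wD p.2 g) x + leibniz f g L x.
Proof. by apply/funext => x; rewrite /leibniz big_cons. Qed.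

Let leibniz_nil f g : leibniz f g [::] = fun=> 0.
Proof. by apply/funext => x; rewrite /leibniz big_nil. Qed.

Lemma smooth_leibniz f g : smooth f -> smooth g -> smooth (cmul f g) /\
  forall s, wD s (cmul f g) =
    fun x => \sum_(p <- splittings s) wD p.1 f x * wD p.2 g x.
Proof.
move=> sf sg; pose F s := leibniz f g (splittings s).
have [||sF EF] := @smooth_family F.
- move=> s; rewrite /F; elim: (splittings s) => [|p L ih].
    by rewrite leibniz_nil; exact: ccont_cst.
  rewrite leibniz_cons; apply: ccontD => //.
  exact: ccontM (smooth_ccont _ sf) (smooth_ccont _ sg).
- move=> s j; rewrite /F /=; elim: (splittings s) => [|p L ih].
    by rewrite /= leibniz_nil; exact: has_partial_cst.
  rewrite leibniz_cons /=.
  have := has_partialD (has_partialM (smooth_has_partial p.1 j sf) (smooth_has_partial p.2 j sg)) ih.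
  rewrite (_ : (fun x => _ + _ + _) = leibniz f g ((j :: p.1, p.2) ::
    [seq (j :: p.1, p.2) | p <- L] ++ (p.1, j :: p.2) :: [seq (p.1, j :: p.2) | p <- L]))//.
  apply/funext => x; rewrite /leibniz big_cons !big_cat big_cons /=.
  by rewrite -!addrA; congr (_ + _); rewrite addrCA.
have E0 : F [::] = cmul f g by apply/funext => x; rewrite /F /leibniz big_seq1.
by rewrite E0 in sF EF.
Qed.

Lemma wD_cmul_bound f g (a b c : nat -> R) x : smooth f -> smooth g ->
  (forall s, cmod (wD s f x) <= a (size s)) ->
  (forall s, cmod (wD s g x) <= b (size s)) ->
  (forall m n : nat, a m * b n <= c (m + n)%N) ->
  forall s, cmod (wD s (cmul f g) x) <= 2 ^+ size s * c (size s).
Proof.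
move=> sf sg ha hb hc s; rewrite (smooth_leibniz sf sg).2.
have -> : (2 : R) ^+ size s * c (size s) = \sum_(p <- splittings s) c (size s).
  by rewrite big_const_seq count_predT size_splittings iter_addr_0 -natrX mulr_natl.
apply: (@le_trans _ _ (\sum_(p <- splittings s) cmod (wD p.1 f x * wD p.2 g x))).
  elim/big_ind2 : _ => [|z1 r1 z2 r2 h1 h2|//]; first by rewrite ComplexField.Normc.normc0.
  by apply: le_trans (cmodD _ _) _; exact: lerD.
rewrite big_seq [leRHS]big_seq; apply: ler_sum => p /mem_splittings <-.
rewrite ComplexField.Normc.normcM; have := hc (size p.1) (size p.2).
by apply: le_trans; apply: ler_pM => //; exact: cmod_ge0.
Qed.

Lemma wD_local (U : set 'rV[R]_d) f g : open U -> (forall x, U x -> f x = g x) ->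
  forall s x, U x -> wD s f x = wD s g x.
Proof.
move=> oU fg; elim=> [|j s ih] x Ux; first exact: fg.
have nU : \forall y \near x, U y by apply: open_nbhs_nbhs.
rewrite /= /partial; congr (_ +i* _)%C; apply: near_eq_derive; apply: filterS nU => y /ih.
- by rewrite /re_part /wD => ->.
- by rewrite /im_part /wD => ->.
Qed.

Lemma wD_eq0 (U : set 'rV[R]_d) f : open U -> (forall x, U x -> f x = 0) ->
  forall s x, U x -> wD s f x = 0.
Proof.
move=> oU f0 s x Ux; rewrite (@wD_local U f 0 oU f0 s x Ux) (wD0 s).
by [].
Qed.

Lemma wD_notin_supp f x s : ~ supp f x -> wD s f x = 0.
Proof.
move=> nx; apply: (@wD_eq0 (~` supp f)) => //.
- by apply: closed_openC; exact: closed_closure.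
- move=> y ny; apply/eqP; apply: contrapT => /negP fy; apply: ny.
  exact: subset_closure.
Qed.

Lemma wD_swap f i j s : smooth f -> wD (i :: j :: s) f = wD (j :: i :: s) f.
Proof.
move=> sf; apply/funext => x.
apply: complex_ext.
- apply: (@schwarz_symmetry _ _ (re_part (wD s f)) (re_part (wD (j :: s) f)) (re_part (wD (i :: s) f))
   (re_part (wD (i :: j :: s) f)) (re_part (wD (j :: i :: s) f)) x (delta_mx 0 j) (delta_mx 0 i)).
  + by move=> y; apply: (smooth_has_partial s j sf y).1.
  + by move=> y; apply: (smooth_has_partial s i sf y).1.
  + by move=> y; apply: (smooth_has_partial (j :: s) i sf y).1.
  + by move=> y; apply: (smooth_has_partial (i :: s) j sf y).1.
  + exact: (smooth_ccont (i :: j :: s) sf).1.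
  + exact: (smooth_ccont (j :: i :: s) sf).1.
- apply: (@schwarz_symmetry _ _ (im_part (wD s f)) (im_part (wD (j :: s) f)) (im_part (wD (i :: s) f))
   (im_part (wD (i :: j :: s) f)) (im_part (wD (j :: i :: s) f)) x (delta_mx 0 j) (delta_mx 0 i)).
  + by move=> y; apply: (smooth_has_partial s j sf y).2.
  + by move=> y; apply: (smooth_has_partial s i sf y).2.
  + by move=> y; apply: (smooth_has_partial (j :: s) i sf y).2.
  + by move=> y; apply: (smooth_has_partial (i :: s) j sf y).2.
  + exact: (smooth_ccont (i :: j :: s) sf).2.
  + exact: (smooth_ccont (j :: i :: s) sf).2.
Qed.

Lemma wD_perm f s t : smooth f -> perm_eq s t -> wD s f = wD t f.
Proof.
move=> sf; elim: s t => [|i s ih] t st.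
  by move: st; rewrite perm_sym => /perm_nilP ->.
have it : i \in t by rewrite -(perm_mem st) mem_head.
case/splitPr: it st => t1 t2 st.
have {}st : perm_eq s (t1 ++ t2) by rewrite -(perm_cons i) (permPl st) -[i :: t2]cat1s perm_catCA.
have -> : wD (t1 ++ i :: t2) f = wD (i :: t1 ++ t2) f.
  elim: t1 {st} => [//|a t1 iht] /=; rewrite -/(wD (t1 ++ i :: t2) f) iht.
  exact: (wD_swap a i (t1 ++ t2) sf).
by rewrite /= -/(wD s f) (ih _ st).
Qed.

Definition word_of (k : {ffun 'I_d -> nat}) : seq 'I_d :=
  flatten [seq nseq (k j) j | j <- enum 'I_d].

Lemma size_word_of k : size (word_of k) = (\sum_(j < d) k j)%N.
Proof.
rewrite /word_of size_flatten /shape -map_comp sumnE big_map enumT.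
by apply: eq_bigr => j _ /=; rewrite size_nseq.
Qed.

Lemma perm_word_of s : perm_eq s (word_of [ffun j => count_mem j s]).
Proof.
apply/allP => j _; apply/eqP; rewrite /word_of count_flatten -map_comp sumnE big_map.
rewrite enumT (bigD1 j) //= count_nseq ffunE /= eqxx mul1n.
by rewrite big1 ?addn0// => i ij; rewrite count_nseq /= (negbTE ij) mul0n.
Qed.

(** The constant collects the factors [1 / i] of [Dop]. *)
Lemma multi_D_word k f : smooth f ->
  exists2 c : R[i], cmod c = 1 & multi_D k f = c *: wD (word_of k) f.
Proof.
move=> sf; rewrite /multi_D /word_of.
elim: (enum 'I_d) => [|j l [c c1 IH]] /=.
  by exists 1; rewrite ?scale1r// ComplexField.Normc.normc1.
rewrite IH; elim: (k j) => [|n [c' c'1 IHn]] /=; first by exists c.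
exists (('i%C)^-1 * c').
  rewrite ComplexField.Normc.normcM ComplexField.Normc.normcV c'1 /=.
  by rewrite expr0n expr1n add0r sqrtr1 invr1 mulr1.
rewrite IHn /Dop -scalerA.
set w := flatten _; have := wDZ c' [:: j] (smooth_wD (nseq n j ++ w) sf).
by rewrite /= => ->.
Qed.

Lemma cmod_multi_D k f x : smooth f -> cmod (multi_D k f x) = cmod (wD (word_of k) f x).
Proof.
move=> sf; have [c c1 ->] := multi_D_word k sf.
by rewrite ComplexField.Normc.normcM c1 mul1r.
Qed.

End Words.

(** * Tensor products and compactness *)

Section TensorProduct.
Variables (R : realType) (d : nat).

(** [v j k] stands for the [k]-th derivative of the [j]-th factor, so that [tensor v s] is already
    the candidate for the derivative along [s] required by [smooth_family]. *)
Definition tensor (v : 'I_d -> nat -> R -> R) (s : seq 'I_d) : cfun R d :=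
  fun x => ((\prod_j v j (count_mem j s) (x 0 j)) +i* 0)%C.

Lemma smooth_tensor (v : 'I_d -> nat -> R -> R) :
  (forall j k (t : R), is_derive t (1 : R) (v j k) (v j k.+1 t)) ->
  smooth (tensor v [::]) /\ forall s, wD s (tensor v [::]) = tensor v s.
Proof.
move=> dv; apply: smooth_family => [s|s i].
- split; last exact: cst_continuous.
  rewrite /re_part /tensor /=; apply: continuous_big => [|j _].
    exact: mul_continuous.
  move=> x; apply: (@continuous_comp _ _ _ (fun y : 'rV[R]_d => y 0 j) (v j (count_mem j s))).
    exact: coord_continuous.
  exact: (is_derive_continuous (dv j _)).
- move=> x; split; last exact: is_derive_cst.
  rewrite -[x in is_derive x]addr0 -(scale0r (delta_mx 0 i)).
  apply/is_derive_lineE; rewrite /re_part /tensor /=.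
  pose C := \prod_(j | j != i) v j (count_mem j s) (x 0 j).
  rewrite (_ : (fun _ => _) = C \*: (fun t : R => v i (count_mem i s) (x 0 i + t))); last first.
    apply/funext => t; rewrite (bigD1 i)//= mulrC; congr (_ * _).
      apply: eq_bigr => j ji; rewrite !mxE /= (negbTE ji) mulr0 addr0//.
    by rewrite !mxE !eqxx mulr1.
  rewrite (bigD1 i)//= eqxx add1n mulrC (_ : \prod_(j | j != i) _ = C); last first.
    by apply: eq_bigr => j ji; rewrite eq_sym (negbTE ji).
  have h := @is_derive_translate R (v i (count_mem i s)) (v i (count_mem i s).+1) (x 0 i) 0 (dv i _ _).
  by rewrite addr0 in h; apply: is_deriveZ.
Qed.

End TensorProduct.

(** * Compactness for the convergence of all derivatives *)

Section Compactness.
Variables (R : realType) (d : nat).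

(** By compactness of [[-B, B]] the image of the ultrafilter has a cluster point, and a cluster
    point of an ultrafilter is a limit. *)
Lemma bounded_ultra_cvg (F : set_system nat) (FU : UltraFilter F) (u : nat -> R) (B : R) :
  (forall n, `|u n| <= B) -> exists l : R, u @ F --> l.
Proof.
move=> uB.
have [|l [_ cl]] := @segment_compact R (- B) B (u @ F) _.
  have FF : Filter F by exact: @filter_filter _ _ (@ultra_proper _ F FU).
  rewrite /fmap /=; apply: (@filterS _ F FF setT) filterT => n _ /=.
  by rewrite in_itv /= -ler_norml.
exists l => A nA; rewrite /= nbhs_filterE.
have [//|FnA] := in_ultra_setVsetC (u @^-1` A) FU.
by have [y [nAy Ay]] := cl (~` A) A FnA nA.
Qed.

Lemma lipschitz_continuous (h : 'rV[R]_d -> R) (B : R) :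
  (forall x y, `|h x - h y| <= B * `|x - y|) -> continuous h.
Proof.
move=> hl x; apply/(@cvgrPdist_le _ _ _ (nbhs x) (@nbhs_filter 'rV[R]_d x)) => e e0.
have B0 := normr_ge0 B.
apply/nbhs_ballP; exists (e / (`|B| + 1)); first by rewrite /= divr_gt0//; lra.
move=> y; rewrite -ball_normE /= => hy; apply: le_trans (hl x y) _.
have : B * `|x - y| <= (`|B| + 1) * `|x - y|.
  by apply: ler_wpM2r => //; have := ler_norm B; lra.
by move: hy; rewrite ltr_pdivlMr; lra.
Qed.

(** Limits along an ultrafilter exist for all words and points at once, without extraction of
    subsequences. Bounds one order higher make the limits Lipschitz, and bounds two orders higher
    allow [is_derive_ultralimit]. *)
Lemma ultra_limit_smooth (F : set_system nat) (FU : UltraFilter F)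
    (fn : nat -> cfun R d) (w : nat -> R) :
  (forall n, smooth (fn n)) ->
  (forall n s x, cmod (wD s (fn n) x) <= w (size s)) ->
  exists f, smooth f /\ forall s x,
    (fun n => complex.Re (wD s (fn n) x)) @ F --> complex.Re (wD s f x) /\
    (fun n => complex.Im (wD s (fn n) x)) @ F --> complex.Im (wD s f x).
Proof.
move=> sf bf.
have bre n s x : `|complex.Re (wD s (fn n) x)| <= w (size s).
  exact: le_trans (Re_le_cmod _) (bf n s x).
have bim n s x : `|complex.Im (wD s (fn n) x)| <= w (size s).
  exact: le_trans (Im_le_cmod _) (bf n s x).
have h1 s x := bounded_ultra_cvg FU (fun n => bre n s x).
have h2 s x := bounded_ultra_cvg FU (fun n => bim n s x).
pose L s : cfun R d := fun x => (proj1_sig (cid (h1 s x)) +i* proj1_sig (cid (h2 s x)))%C.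
have c1 s x : (fun n => re_part (wD s (fn n)) x) @ F --> re_part (L s) x.
  exact: (proj2_sig (cid (h1 s x))).
have c2 s x : (fun n => im_part (wD s (fn n)) x) @ F --> im_part (L s) x.
  exact: (proj2_sig (cid (h2 s x))).
have FP : ProperFilter F by exact: ultra_proper.
have lip (g : nat -> 'rV[R]_d -> R) (h : 'rV[R]_d -> R) (B : R) :
    (forall n x y, `|g n x - g n y| <= B * `|x - y|) ->
    (forall x, g ^~ x @ F --> h x) -> continuous h.
  move=> gl gc; apply: (@lipschitz_continuous _ B) => x y.
  apply: (@closed_cvg _ _ F FP (fun n => `|g n x - g n y|) [set z | z <= B * `|x - y|]).
  - exact: closed_le.
  - by apply: nearW => n /=; apply: gl.
  - by apply: cvg_norm; apply: cvgB.
have [||sL EL] := @smooth_family R d L.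
- move=> s; split.
  + apply: (@lip (fun n => re_part (wD s (fn n))) _ (d%:R * w (size s).+1)) => // n x y.
    apply: (@partial_bound_lipschitz _ _ _ (fun j => re_part (wD (j :: s) (fn n)))) => j z.
    * exact: (smooth_has_partial s j (sf n) z).1.
    * exact: bre n (j :: s) z.
  + apply: (@lip (fun n => im_part (wD s (fn n))) _ (d%:R * w (size s).+1)) => // n x y.
    apply: (@partial_bound_lipschitz _ _ _ (fun j => im_part (wD (j :: s) (fn n)))) => j z.
    * exact: (smooth_has_partial s j (sf n) z).2.
    * exact: bim n (j :: s) z.
- move=> s j x; split.
  + apply: (@is_derive_ultralimit _ _ F FP (fun n => re_part (wD s (fn n)))
     (fun n => re_part (wD (j :: s) (fn n))) (fun n => re_part (wD (j :: j :: s) (fn n)))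
     (re_part (L s)) (re_part (L (j :: s))) _ (w (size s).+2)) => // n y.
    * exact: (smooth_has_partial s j (sf n) y).1.
    * exact: (smooth_has_partial (j :: s) j (sf n) y).1.
    * exact: bre n (j :: j :: s) y.
  + apply: (@is_derive_ultralimit _ _ F FP (fun n => im_part (wD s (fn n)))
     (fun n => im_part (wD (j :: s) (fn n))) (fun n => im_part (wD (j :: j :: s) (fn n)))
     (im_part (L s)) (im_part (L (j :: s))) _ (w (size s).+2)) => // n y.
    * exact: (smooth_has_partial s j (sf n) y).2.
    * exact: (smooth_has_partial (j :: s) j (sf n) y).2.
    * exact: bim n (j :: j :: s) y.
exists (L [::]); split=> // s x; rewrite EL; split; [exact: c1|exact: c2].
Qed.

(** The norm of row vectors is the maximum norm. *)
Definition cube (m : R) : set 'rV[R]_d := [set x | `|x| <= m].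

Lemma cube_compact m : compact (cube m).
Proof.
apply: bounded_closed_compact.
- exists m; split; first exact: num_real.
  by move=> y my x /= xm; apply: le_trans xm (ltW my).
- rewrite (_ : cube m = (fun x : 'rV[R]_d => `|x|) @^-1` [set t : R | t <= m])//.
  by apply: preimage_closed; [move=> x _; exact: norm_continuous|exact: closed_le].
Qed.

(** The common Lipschitz constant spreads smallness at one point to a neighbourhood of fixed size;
    compactness then leaves finitely many points. *)
Lemma cvg_uniform_on_compact (F : set_system nat) (FF : Filter F)
    (g : nat -> 'rV[R]_d -> R) (K : set 'rV[R]_d) (B : R) :
  compact K -> (forall n x y, `|g n x - g n y| <= B * `|x - y|) ->
  (forall x, g ^~ x @ F --> 0) ->
  forall e, 0 < e -> \forall n \near F, forall x, K x -> `|g n x| <= e.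
Proof.
move=> /compact_near_coveringP cK gl gc e e0.
apply: (cK _ F (fun n x => `|g n x| <= e)) => x Kx.
have B0 := normr_ge0 B.
have hx : \forall n \near F, `|g n x| <= e / 2.
  have /cvgrPdist_le /(_ (e / 2)) := gc x; rewrite divr_gt0// => /(_ isT).
  by apply: filterS => n; rewrite sub0r normrN.
near=> y n.
have -> : g n y = g n x + (g n y - g n x) by ring.
have e20 : 0 < e / 2 by lra.
have h1 : `|g n x| <= e / 2 by near: n; exact: hx.
have h2 : `|y - x| <= e / 2 / (`|B| + 1).
  near: y; rewrite /=; under eq_near do rewrite distrC.
  by apply: cvgr_dist_le => //; apply: divr_gt0 => //; lra.
apply: le_trans (ler_normD _ _) _.
have h3 : B * `|y - x| <= (`|B| + 1) * `|y - x|.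
  by apply: ler_wpM2r => //; have := ler_norm B; lra.
have h4 : (`|B| + 1) * `|y - x| <= e / 2 by rewrite mulrC -ler_pdivlMr//; lra.
have := gl n y x; lra.
Unshelve. all: by end_near. Qed.

End Compactness.

(** * Regular cubes, weights and norms *)

Section RegularCubes.
Variables (R : realType) (d : nat).
Implicit Types x y : 'rV[R]_d.

Lemma eucl_normZ (t : R) x : 0 <= t -> eucl_norm (t *: x) = t * eucl_norm x.
Proof.
move=> t0; rewrite /eucl_norm -[t in RHS]ger0_norm// -sqrtr_sqr -sqrtrM ?sqr_ge0//.
by congr Num.sqrt; rewrite mulr_sumr; apply: eq_bigr => j _; rewrite mxE exprMn.
Qed.

Lemma eucl_normN x : eucl_norm (- x) = eucl_norm x.
Proof. by congr Num.sqrt; apply: eq_bigr => j _; rewrite mxE sqrrN. Qed.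

Let segment x y (t : R) := x + t *: (y - x).

Let continuous_segment x y : continuous (segment x y).
Proof.
move=> t; apply: cvgD; first exact: cvg_cst.
by apply: cvgZ; [exact: cvg_id|exact: cvg_cst].
Qed.

Lemma segment_length x y : (curve_length (segment x y) <= (eucl_norm (x - y))%:E)%E.
Proof.
apply: ge_ereal_sup => _ [s [ps /eqP ls] <-]; rewrite lee_fin.
have -> : \sum_(0 <= m < size s) eucl_norm (segment x y (nth 1 (0 :: s) m.+1) - segment x y (nth 1 (0 :: s) m))
  = \sum_(0 <= m < size s) (nth 1 (0 :: s) m.+1 - nth 1 (0 :: s) m) * eucl_norm (x - y).
  rewrite big_nat [RHS]big_nat; apply: eq_bigr => m /andP[_ ms].
  have -> : segment x y (nth 1 (0 :: s) m.+1) - segment x y (nth 1 (0 :: s) m) =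
     (nth 1 (0 :: s) m.+1 - nth 1 (0 :: s) m) *: (y - x).
    by rewrite /segment opprD addrACA subrr add0r scalerBl.
  rewrite eucl_normZ; first by rewrite -(eucl_normN (x - y)) opprB.
  by rewrite subr_ge0; apply: ltW; move/(pathP 1) : ps => /(_ _ ms).
rewrite -mulr_suml telescope_sumr// /=.
have -> : nth 1 (0 :: s) (size s) = 1 by rewrite nth_last.
by rewrite subr0 mul1r.
Qed.

(** By convexity, segments give connectedness and curves of length at most [eucl_norm (x - y)]. A
    point [x] of the boundary is approached by the interior points [(1 - s) *: x]. *)
Lemma cube_regular (m : R) : 0 < m -> regular_compact (@cube R d m).
Proof.
move=> m0.
have Kc := @cube_compact R d m.
have conv x y t : cube m x -> cube m y -> 0 <= t <= 1 -> cube m (segment x y t).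
  move=> xm ym /andP[t0 t1]; rewrite /cube /= /segment.
  have -> : x + t *: (y - x) = (1 - t) *: x + t *: y.
    by rewrite scalerBr scalerBl scale1r addrA addrAC.
  apply: le_trans (ler_normD _ _) _; rewrite !normrZ (ger0_norm t0) ger0_norm; last by lra.
  have : (1 - t) * `|x| <= (1 - t) * m by apply: ler_wpM2l => //; lra.
  have : t * `|y| <= t * m by apply: ler_wpM2l.
  by lra.
have seg_img x y : cube m x -> cube m y -> segment x y @` `[0, 1]%classic `<=` cube m.
  by move=> xm ym _ [t + <-]; rewrite /= in_itv /=; apply: conv.
have K0 : cube m (0 : 'rV[R]_d) by rewrite /cube /= normr0 ltW.
have comp0 : connected_component (cube m) (0 : 'rV[R]_d) = cube m.
  apply/seteqP; split; first exact: connected_component_sub.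
  move=> y ym; have h : connected (segment 0 y @` `[0, 1]%classic).
    apply: connected_continuous_connected; first exact: segment_connected.
    exact: continuous_subspaceT.
  apply: (connected_component_max _ (seg_img 0 y K0 ym) h).
  - by exists 0; [rewrite /= in_itv /= lexx ler01|rewrite /segment scale0r addr0].
  - by exists 1; [rewrite /= in_itv /= lexx ler01|rewrite /segment scale1r add0r subr0].
have Kcon : connected (cube m : set 'rV[R]_d) by rewrite -comp0; exact: component_connected.
split; first exact: Kc.
- apply/seteqP; split.
    have cK := compact_closed (@norm_hausdorff _ _) Kc.
    apply: subset_trans (closure_subset (@interior_subset _ _)) _.
    by rewrite -(closure_id _).1.
  move=> x xm B /nbhs_ballP[e /= e0 eB].
  have x1 : 0 < `|x| + 1 by have := normr_ge0 x; lra.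
  pose s := Num.min 1 (e / (2 * (`|x| + 1))).
  have s0 : 0 < s by rewrite lt_min ltr01 divr_gt0// mulr_gt0.
  have s1 : s <= 1 by rewrite ge_min lexx.
  have se : s * `|x| < e.
    have : s <= e / (2 * (`|x| + 1)) by rewrite ge_min lexx orbT.
    rewrite ler_pdivlMr ?mulr_gt0//; have := normr_ge0 x.
    by have := mulr_gt0 s0 x1; lra.
  exists ((1 - s) *: x); split.
  + have ym : `|(1 - s) *: x| < m.
      rewrite normrZ ger0_norm; last by lra.
      have : (1 - s) * `|x| <= (1 - s) * m by apply: ler_wpM2l => //; lra.
      by have := mulr_gt0 s0 m0; lra.
    apply/nbhs_ballP; exists (m - `|(1 - s) *: x|); first by rewrite /= subr_gt0.
    move=> z; rewrite -ball_normE /= /cube /= => h.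
    have := ler_normB ((1 - s) *: x) ((1 - s) *: x - z); rewrite opprB addrC subrK; lra.
  + apply: eB; rewrite -ball_normE /=.
    rewrite scalerBl scale1r opprB addrC subrK normrZ gtr0_norm//.
- apply: (sub_finite_set _ (finite_set1 (cube m))).
  by move=> _ [x xm <-] /=; rewrite connected_component_id.
- exists 1 => x y xm /connected_component_sub ym; exists (segment x y); split.
  + exact: continuous_subspaceT.
  + exact: seg_img.
  + by rewrite /segment scale0r addr0.
  + by rewrite /segment scale1r addrC subrK.
  + by rewrite mul1r; exact: segment_length.
Qed.

Lemma compact_sub_cube (K : set 'rV[R]_d) : compact K ->
  exists2 m : nat, (0 < m)%N & K `<=` cube m%:R.
Proof.
move=> /compact_bounded[B [_ hB]].
have [m hm] : exists m : nat, `|B| + 1 < m%:R.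
  by exists (Num.truncn (`|B| + 1)).+1; rewrite truncnS_gt.
exists m.
  by rewrite -(ltr_nat R); apply: le_lt_trans hm; have := normr_ge0 B; lra.
move=> x Kx; apply: le_trans (hB (`|B| + 1) _ x Kx) (ltW hm).
by have := ler_norm B; lra.
Qed.

End RegularCubes.

(** * Weighted norms as pointwise bounds along words *)

Section WeightedNorms.
Variables (R : realType) (d : nat).
Implicit Types (f : cfun R d) (K : set 'rV[R]_d) (w : nat -> R).

Definition word_bound K w f := forall s x, K x -> cmod (wD s f x) <= w (size s).

(** Every word is a permutation of the [word_of] of its letter counts, so by symmetry of derivatives
    bounds over multi-indices control all words. *)
Lemma weighted_norm_leP K w f (C : R) : (forall p, 0 < w p) -> smooth f -> 0 <= C ->
  (weighted_norm K w f <= C%:E)%E <-> word_bound K (fun p => C * w p) f.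
Proof.
move=> w0 sf C0; split=> [h s x Kx|h].
- have -> : wD s f = wD (word_of [ffun j => count_mem j s]) f.
    exact: wD_perm (perm_word_of s).
  rewrite -cmod_multi_D// (perm_size (perm_word_of s)) size_word_of.
  set k := [ffun j => _].
  have h1 : ((cmod (multi_D k f x))%:E <= sup_norm K (multi_D k f))%E.
    by apply: ereal_sup_ubound; right; exists x.
  have h2 : (sup_norm K (multi_D k f) * ((w (\sum_(j < d) k j)%N)^-1)%:E <= C%:E)%E.
    by apply: le_trans h; apply: ereal_sup_ubound; exists k.
  have wi : (0 <= ((w (\sum_(j < d) k j)%N)^-1)%:E)%E by rewrite lee_fin invr_ge0 ltW.
  have := le_trans (lee_wpmul2r wi h1) h2.
  by rewrite -EFinM lee_fin ler_pdivrMr.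
- apply: ge_ereal_sup => _ [k _ <-].
  have wi : (0 <= ((w (\sum_(j < d) k j)%N)^-1)%:E)%E by rewrite lee_fin invr_ge0 ltW.
  have h1 : (sup_norm K (multi_D k f) <= (C * w (\sum_(j < d) k j)%N)%:E)%E.
    apply: ge_ereal_sup => _ [->|[x Kx <-]]; first by rewrite lee_fin mulr_ge0// ltW.
    by rewrite lee_fin cmod_multi_D// -size_word_of; apply: h.
  apply: le_trans (lee_wpmul2r wi h1) _.
  by rewrite -EFinM lee_fin mulfK// gt_eqF.
Qed.

Lemma weighted_norm_ge0 K w f : (forall p, 0 < w p) -> (0 <= weighted_norm K w f)%E.
Proof.
move=> w0; pose k := [ffun _ : 'I_d => 0%N].
apply: (@le_trans _ _ (sup_norm K (multi_D k f) * ((w (\sum_(j < d) k j)%N)^-1)%:E)%E).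
  apply: mule_ge0; last by rewrite lee_fin invr_ge0 ltW.
  by apply: ereal_sup_ubound; left.
by apply: ereal_sup_ubound; exists k.
Qed.

Lemma weighted_norm_fin K w f : (forall p, 0 < w p) -> smooth f ->
  (weighted_norm K w f < +oo)%E ->
  exists C : R, [/\ 0 <= C, weighted_norm K w f = C%:E & word_bound K (fun p => C * w p) f].
Proof.
move=> w0 sf; have := weighted_norm_ge0 K f w0.
case E : (weighted_norm K w f) => [C| |]// C0 _; exists C; split=> //.
by apply/weighted_norm_leP => //; rewrite E.
Qed.

End WeightedNorms.

(** * Growth of product sequences and logarithmic convexity *)

Section Weights.
Variable R : realType.
Implicit Types (r M : nat -> R).

Lemma classR_ge1 r : classR r -> forall i, 1 <= r i.
Proof. by case=> <- + _ i; apply. Qed.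

Lemma classR_ge r (B : R) : classR r -> exists N, forall i, (N <= i)%N -> B <= r i.
Proof.
by case=> _ _ /cvgryPge /(_ B)[N _ hN]; exists N => i /hN.
Qed.

Lemma product_seqS r p : product_seq r p.+1 = product_seq r p * r p.+1.
Proof. by rewrite /product_seq big_nat_recr. Qed.

Lemma product_seq0 r : r 0 = 1 -> product_seq r 0 = 1.
Proof. by move=> r0; rewrite /product_seq big_nat1. Qed.

Lemma product_seq_gt0 r p : (forall i, 1 <= r i) -> 0 < product_seq r p.
Proof.
move=> r1; have r0 i : 0 < r i by apply: lt_le_trans (r1 i).
by elim: p => [|p ih]; [rewrite /product_seq big_nat1|rewrite product_seqS mulr_gt0].
Qed.

Lemma product_seq_supermul r i j : r 0 = 1 -> {homo r : m n / (m <= n)%N >-> m <= n} ->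
  product_seq r i * product_seq r j <= product_seq r (i + j).
Proof.
move=> r0 hr; have r1 k : 1 <= r k by rewrite -r0; apply: hr.
elim: j => [|j ih]; first by rewrite addn0 product_seq0// mulr1.
rewrite addnS !product_seqS mulrA; apply: ler_pM => //.
- by rewrite mulr_ge0// ltW// product_seq_gt0.
- by apply: le_trans (r1 _).
- by apply: hr; rewrite ltnS leq_addl.
Qed.

(** Only the first [N] factors can violate [u i <= r i], and each of them costs at most a factor
    [c]. *)
Lemma prod_le_tail (u r : nat -> R) (c : R) N p : 1 <= c -> (forall i, 0 <= u i) ->
  (forall i, 0 <= r i) -> (forall i, u i <= c * r i) -> (forall i, (N <= i)%N -> u i <= r i) ->
  \prod_(0 <= i < p) u i <= c ^+ N * \prod_(0 <= i < p) r i.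
Proof.
move=> c1 u0 r0 uc uN; have c0 : 0 <= c by lra.
have P0 q : 0 <= \prod_(0 <= i < q) r i by apply: prodr_ge0.
(* The induction on [p] needs the exponent that counts only the costly factors already met. *)
apply: (@le_trans _ _ (c ^+ (minn p N) * \prod_(0 <= i < p) r i)); last first.
  by apply: ler_wpM2r => //; apply: ler_weXn2l => //; exact: geq_minr.
elim: p => [|p ih]; first by rewrite !big_geq// min0n mulr1.
rewrite !big_nat_recr//=.
have U0 : 0 <= \prod_(0 <= i < p) u i by apply: prodr_ge0.
have [Np|pN] := leqP N p.
  move: ih; rewrite (minn_idPr Np) (minn_idPr (leqW Np)) => ih.
  by rewrite mulrA; apply: ler_pM => //; exact: uN.
move: ih; rewrite (minn_idPl (ltnW pN)) (minn_idPl pN) => ih.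
have -> : c ^+ p.+1 * (\prod_(0 <= i < p) r i * r p) =
  (c ^+ p * \prod_(0 <= i < p) r i) * (c * r p) by rewrite exprS; ring.
exact: ler_pM.
Qed.

(** Only finitely many [r i] lie below [h]. Consequently every [R_norm] is finite on test
    functions. *)
Lemma geometric_le_product_seq r (h : R) : classR r -> 0 < h ->
  exists2 C, 0 < C & forall p, h ^+ p <= C * product_seq r p.
Proof.
move=> cr h0; have r1 := classR_ge1 cr.
pose H := Num.max 1 h.
have H1 : 1 <= H by rewrite le_max lexx.
have [N hN] := classR_ge H cr.
exists (H ^+ N); first by apply: exprn_gt0; lra.
move=> p; apply: (@le_trans _ _ (\prod_(0 <= i < p.+1) H)).
  rewrite big_const_nat subn0 iter_mulr_1; apply: (@le_trans _ _ (H ^+ p)).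
    by apply: lerXn2r; rewrite ?nnegrE ?le_max ?lexx ?orbT//; lra.
  by apply: ler_weXn2l.
apply: prod_le_tail => // i; first by lra.
- exact: le_trans (r1 i).
- by rewrite ler_peMr//; lra.
Qed.

(** Serves to absorb the factor [2 ^+ p] of the Leibniz rule. The sequence is [r / 2], cut off below
    at 1 so as to stay in the class. *)
Lemma classR_half r : classR r -> exists r', classR r' /\
  exists2 C, 0 < C & forall p, 2 ^+ p * product_seq r' p <= C * product_seq r p.
Proof.
move=> cr; have r1 := classR_ge1 cr; have [r0 hr ir] := cr.
exists (fun i => Num.max 1 (r i / 2)); split.
  split.
  - by rewrite r0; apply/max_idPl; lra.
  - by move=> m n /hr mn; rewrite ge_max !le_max lexx /=; apply/orP; right; lra.
  - apply/cvgryPge => A; move/cvgryPge: ir => /(_ (2 * A)); apply: filterS => n h.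
    by rewrite le_max; apply/orP; right; lra.
have [N hN] := classR_ge 2 cr.
exists (2 ^+ N); first by apply: exprn_gt0.
move=> p; apply: (@le_trans _ _ (\prod_(0 <= i < p.+1) (2 * Num.max 1 (r i / 2)))).
  rewrite big_split /= big_const_nat subn0 iter_mulr_1; apply: ler_wpM2r.
    by apply/ltW/product_seq_gt0 => i; rewrite le_max lexx.
  by apply: ler_weXn2l => //; lra.
apply: prod_le_tail; first by lra.
- by move=> i; rewrite mulr_ge0// le_max ler01.
- by move=> i; exact: le_trans (r1 i).
- by move=> i; have := r1 i; rewrite /Num.max; case: ifPn; lra.
- by move=> i /hN; rewrite /Num.max; case: ifPn; lra.
Qed.

(** By (M.1) the ratios [M p.+1 / M p] increase, and [M (i + j) / M i] is a product of later ratios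
    than [M j / M 0]. *)
Lemma log_convex_supermul M i j : (forall p, 0 < M p) -> M 0 = 1 -> M1 M -> M i * M j <= M (i + j)%N.
Proof.
move=> Mp M01 h1.
have ratio m n : (m <= n)%N -> M m.+1 / M m <= M n.+1 / M n.
  move=> /subnK <-; elim: (n - m)%N => [//|k ih].
  apply: le_trans ih _; rewrite addSn ler_pdivrMr// mulrAC ler_pdivlMr// mulrC.
  by have := h1 (k + m).+1 isT; rewrite /= expr2 [M (k + m)%N * _]mulrC.
elim: j => [|j ih]; first by rewrite M01 mulr1 addn0.
have := ratio j (i + j)%N (leq_addl _ _).
rewrite ler_pdivrMr// mulrAC ler_pdivlMr// addnS => h.
rewrite -(ler_pM2r (Mp j)); apply: le_trans (_ : M (i + j)%N * M j.+1 <= _).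
  by rewrite -mulrA [M j.+1 * _]mulrC mulrA; apply: ler_wpM2r => //; exact: ltW.
by rewrite mulrC.
Qed.

End Weights.

(** * Test functions and cutoffs *)

Section TestFunctions.
Variables (R : realType) (d : nat) (M : nat -> R).
Hypotheses (M_gt0 : forall p, 0 < M p) (M_0 : M 0 = 1)
  (M_supermul : forall i j, M i * M j <= M (i + j)%N).
Implicit Types (f g : cfun R d) (K : set 'rV[R]_d) (r : nat -> R) (x y : 'rV[R]_d).

Definition roumieu_weight (C h : R) (p : nat) : R := C * (h ^+ p * M p).

Lemma roumieu_weight_gt0 h p : 0 < h -> 0 < h ^+ p * M p.
Proof. by move=> h0; rewrite mulr_gt0// exprn_gt0. Qed.

Lemma roumieu_weight_le C C' h h' p : 0 <= C -> C <= C' -> 0 <= h -> h <= h' ->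
  roumieu_weight C h p <= roumieu_weight C' h' p.
Proof.
move=> C0 CC h0 hh; rewrite /roumieu_weight; apply: ler_pM => //.
- by rewrite mulr_ge0 ?exprn_ge0// ltW.
- by apply: ler_wpM2r; [exact: ltW|apply: lerXn2r; rewrite ?nnegrE//; exact: le_trans hh].
Qed.

Lemma word_bound_le K (w w' : nat -> R) f : (forall p, w p <= w' p) ->
  word_bound K w f -> word_bound K w' f.
Proof. by move=> ww wf s x Kx; apply: le_trans (wf s x Kx) _. Qed.

Lemma word_boundD K (w1 w2 : nat -> R) f g : smooth f -> smooth g ->
  word_bound K w1 f -> word_bound K w2 g -> word_bound K (fun p => w1 p + w2 p) (f + g).
Proof.
move=> sf sg wf wg s x Kx; rewrite wDD//.
by apply: le_trans (cmodD _ _) _; apply: lerD; [exact: wf|exact: wg].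
Qed.

Lemma word_boundZ K (w : nat -> R) (a : R[i]) f : smooth f ->
  word_bound K w f -> word_bound K (fun p => cmod a * w p) (a *: f).
Proof.
move=> sf wf s x Kx; rewrite wDZ// ComplexField.Normc.normcM.
by apply: ler_wpM2l; [exact: cmod_ge0|exact: wf].
Qed.

Lemma word_boundB K (w1 w2 : nat -> R) f g : smooth f -> smooth g ->
  word_bound K w1 f -> word_bound K w2 g -> word_bound K (fun p => w1 p + w2 p) (f - g).
Proof.
move=> sf sg wf wg s x Kx; rewrite wDB//.
by apply: le_trans (cmodB _ _) _; apply: lerD; [exact: wf|exact: wg].
Qed.

Lemma word_bound_cmul_roumieu K C h C' h' f g : smooth f -> smooth g ->
  0 <= C -> 0 < h -> 0 <= C' -> 0 < h' ->
  word_bound K (roumieu_weight C h) f -> word_bound K (roumieu_weight C' h') g ->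
  word_bound K (roumieu_weight (C * C') (2 * Num.max h h')) (cmul f g).
Proof.
move=> sf sg C0 h0 C'0 h'0 wf wg s x Kx.
have m0 : 0 < Num.max h h' by rewrite lt_max h0.
have -> : roumieu_weight (C * C') (2 * Num.max h h') (size s) =
  2 ^+ size s * roumieu_weight (C * C') (Num.max h h') (size s).
  by rewrite /roumieu_weight exprMn; ring.
apply: (wD_cmul_bound sf sg (fun t => wf t x Kx) (fun t => wg t x Kx)) => i j.
rewrite /roumieu_weight mulrACA; apply: ler_wpM2l; first exact: mulr_ge0.
rewrite exprD mulrACA; apply: ler_pM => //.
- by rewrite mulr_ge0// exprn_ge0// ltW.
- by rewrite mulr_ge0// ltW.
- by apply: ler_pM; rewrite ?exprn_ge0 ?lerXn2r ?nnegrE ?le_max ?lexx ?orbT// ltW.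
Qed.

Lemma word_bound_cmul_product r A B K f g : smooth f -> smooth g -> classR r ->
  0 <= A -> 0 <= B ->
  word_bound K (fun p => A * (product_seq r p * M p)) f ->
  word_bound K (fun p => B * (product_seq r p * M p)) g ->
  word_bound K (fun p => 2 ^+ p * (A * B * (product_seq r p * M p))) (cmul f g).
Proof.
move=> sf sg cr A0 B0 wf wg s x Kx; have [r0 hr _] := cr.
have Pp p : 0 < product_seq r p by apply/product_seq_gt0/classR_ge1.
apply: (wD_cmul_bound (c := fun p => A * B * (product_seq r p * M p)) sf sg
  (fun t => wf t x Kx) (fun t => wg t x Kx)) => i j.
rewrite mulrACA; apply: ler_wpM2l; first exact: mulr_ge0.
rewrite mulrACA; apply: ler_pM => //.
- by rewrite mulr_ge0// ltW.
- by rewrite mulr_ge0// ltW.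
- exact: product_seq_supermul.
Qed.

Lemma zero_outside_supp (m : R) f : (forall x, m < `|x| -> f x = 0) -> supp f `<=` cube m.
Proof.
move=> f0; have cK := compact_closed (@norm_hausdorff _ _) (@cube_compact R d m).
rewrite /supp [X in _ `<=` X](closure_id _).1//; apply: closure_subset => x /= fx.
by rewrite /cube /= leNgt; apply/negP => /f0 /eqP; apply/negP.
Qed.

Lemma open_outside (m : R) : open [set x : 'rV[R]_d | m < `|x|].
Proof.
have -> : [set x : 'rV[R]_d | m < `|x|] = ~` cube m.
  apply/seteqP; split => x; rewrite /cube /=; first by rewrite ltNge => /negP.
  by move/negP; rewrite -ltNge.
apply: closed_openC; exact: compact_closed (@norm_hausdorff _ _) (@cube_compact R d m).
Qed.

Lemma open_inside (m : R) : open [set x : 'rV[R]_d | `|x| < m].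
Proof.
rewrite (_ : [set x : 'rV[R]_d | `|x| < m] = (fun x : 'rV[R]_d => `|x|) @^-1` [set t : R | t < m])//.
by apply: open_comp; [move=> x _; exact: norm_continuous|exact: open_lt].
Qed.

Lemma wD_outside (m : R) f s x : (forall x, m < `|x| -> f x = 0) -> m < `|x| -> wD s f x = 0.
Proof. by move=> f0 mx; exact: (wD_eq0 (@open_outside m) f0). Qed.

Lemma wD_inside (m : R) f s x : (forall x, cube m x -> f x = 0) -> `|x| < m -> wD s f x = 0.
Proof.
move=> f0 mx; apply: (wD_eq0 (@open_inside m)) mx.
by move=> y /ltW; exact: f0.
Qed.

(** The support is a closure, so [f] is required to vanish on a strictly larger cube than the one
    containing [K]. *)
Lemma supp_disjoint (m m' : R) K f : K `<=` cube m -> m < m' ->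
  (forall x, cube m' x -> f x = 0) -> supp f `&` K = set0.
Proof.
move=> Km mm f0; apply/seteqP; split => // x [fx /Km xm].
have [|y [/= /negP fy ym]] := fx [set x : 'rV[R]_d | `|x| < m'].
  by apply: open_nbhs_nbhs; split; [exact: open_inside|exact: le_lt_trans xm mm].
by apply: fy; apply/eqP/f0; exact: ltW.
Qed.

Lemma zero_off_supp K f x : supp f `&` K = set0 -> K x -> f x = 0.
Proof.
move=> fK Kx; apply/eqP; apply: contrapT => /negP fx.
suff : set0 x by [].
by rewrite -fK; split => //; exact: subset_closure.
Qed.

(** The carriers of the inductive limits are unions, cubes absorb all compact sets, and a bound on a
    compact set containing the support is a bound everywhere. *)
Lemma test_functionP f : test_function M f <-> exists (m : nat) C h,
  [/\ (0 < m)%N, 0 <= C /\ 0 < h, smooth f, forall x, m%:R < `|x| -> f x = 0 &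
      word_bound setT (roumieu_weight C h) f].
Proof.
split=> [[K [cK _ _ _] [h /= h0 [[sf fK] fq]]]|[m [C [h [m0 [C0 h0] sf f0 wf]]]]].
- have w0 p : 0 < h ^+ p * M p by exact: roumieu_weight_gt0.
  have [C [C0 _ wf]] := weighted_norm_fin w0 sf fq.
  have [m m0 Km] := compact_sub_cube cK.
  exists m, C, h; split => //.
    move=> x mx; apply/eqP; apply: contrapT => /negP fx.
    have /Km : K x by apply/fK/subset_closure.
    by rewrite /cube /= leNgt mx.
  move=> s x _; have [Kx|nKx] := pselect (K x); first exact: wf.
  rewrite wD_notin_supp; last by move=> /fK.
  by rewrite ComplexField.Normc.normc0 mulr_ge0// ltW.
- exists (cube m%:R); first by apply: cube_regular; rewrite ltr0n.
  exists h => //; split; first by split => //; exact: zero_outside_supp.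
  have w0 p : 0 < h ^+ p * M p by exact: roumieu_weight_gt0.
  apply: (@le_lt_trans _ _ C%:E); last exact: ltry.
  by apply/weighted_norm_leP => // s x _; exact: wf.
Qed.

Lemma test_function_lin (a : R[i]) f g :
  test_function M f -> test_function M g -> test_function M (a *: f + g).
Proof.
move=> /test_functionP[m [C [h [m0 [C0 h0] sf f0 wf]]]].
move=> /test_functionP[m' [C' [h' [m'0 [C'0 h'0] sg g0 wg]]]].
apply/test_functionP; exists (maxn m m'), (cmod a * C + C'), (Num.max h h').
have c0 := cmod_ge0 a; split.
- by rewrite leq_max m0.
- by split; [rewrite addr_ge0// mulr_ge0|rewrite lt_max h0].
- exact: (smooth_lin _ sf sg).1.
- move=> x mx.
  have m1 : m%:R <= (maxn m m')%:R :> R by rewrite ler_nat leq_maxl.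
  have m2 : m'%:R <= (maxn m m')%:R :> R by rewrite ler_nat leq_maxr.
  rewrite (_ : (a *: f + g) x = a * f x + g x)//.
  by rewrite f0 ?(le_lt_trans m1)// g0 ?(le_lt_trans m2)// mulr0 addr0.
- apply: word_bound_le (word_boundD (smoothZ a sf) sg (word_boundZ a sf wf) wg) => p.
  rewrite [leRHS]mulrDl -/(roumieu_weight C' _ p); apply: lerD; last first.
    by apply: roumieu_weight_le; rewrite ?lexx ?le_max ?lexx ?orbT// ltW.
  rewrite -mulrA; apply: ler_wpM2l => //; apply: ler_wpM2l => //.
  apply: ler_wpM2r; first exact: ltW.
  by apply: lerXn2r; rewrite ?nnegrE ?le_max ?lexx ?(ltW h0)// ltW.
Qed.

Lemma test_functionZ (a : R[i]) f : test_function M f -> test_function M (a *: f).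
Proof.
move=> tf; rewrite -[a *: f]addr0; apply: test_function_lin => //.
apply/test_functionP; exists 1%N, 0, 1; split => //; first exact: smooth_cst.
by move=> s x _; rewrite wD0 ComplexField.Normc.normc0 /roumieu_weight mul0r.
Qed.

Lemma test_functionB f g : test_function M f -> test_function M g -> test_function M (f - g).
Proof.
by move=> tf tg; rewrite addrC -scaleN1r; exact: test_function_lin.
Qed.

Lemma test_function0 : test_function M (0 : cfun R d).
Proof.
apply/test_functionP; exists 1%N, 0, 1; split => //; first exact: smooth_cst.
by move=> s x _; rewrite wD0 ComplexField.Normc.normc0 /roumieu_weight mul0r.
Qed.

Lemma test_function_smooth f : test_function M f -> smooth f.
Proof. by move=> /test_functionP[m [C [h []]]]. Qed.

Lemma test_R_norm_fin r f : classR r -> test_function M f ->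
  exists A : R, [/\ 0 <= A, R_norm M r f = A%:E &
    word_bound setT (fun p => A * (product_seq r p * M p)) f].
Proof.
move=> cr tf; have sf := test_function_smooth tf.
have w0 p : 0 < product_seq r p * M p.
  by rewrite mulr_gt0//; apply/product_seq_gt0/classR_ge1.
apply: weighted_norm_fin => //.
have /test_functionP[m [C [h [m0 [C0 h0] _ f0 wf]]]] := tf.
have [B B0 hB] := geometric_le_product_seq cr h0.
apply: (@le_lt_trans _ _ (C * B)%:E); last exact: ltry.
apply/weighted_norm_leP => //; first by rewrite mulr_ge0// ltW.
apply: word_bound_le wf => p; rewrite /roumieu_weight -mulrA; apply: ler_wpM2l => //.
by rewrite mulrA; apply: ler_wpM2r => //; exact: ltW.
Qed.

Lemma R_norm_le r f (A : R) : classR r -> smooth f -> 0 <= A ->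
  word_bound setT (fun p => A * (product_seq r p * M p)) f -> (R_norm M r f <= A%:E)%E.
Proof.
move=> cr sf A0 wf; apply/weighted_norm_leP => // p.
by rewrite mulr_gt0//; apply/product_seq_gt0/classR_ge1.
Qed.

Lemma word_bound_cst1 : word_bound setT (roumieu_weight 1 1) ((fun=> 1) : cfun R d).
Proof.
move=> s x _; rewrite wD_cst /roumieu_weight mul1r expr1n mul1r; case: s => [|j s].
  by rewrite ComplexField.Normc.normc1 M_0.
by rewrite ComplexField.Normc.normc0 ltW.
Qed.

(** * Dilated cutoffs *)

Section Cutoff.
Variables (H : R) (v : nat -> R -> R).
Hypotheses (H_ge1 : 1 <= H)
  (dv : forall k (x : R), is_derive x (1 : R) (v k) (v k.+1 x))
  (v_bound : forall k (x : R), `|v k x| <= H ^+ k * M k)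
  (v_one : forall x : R, `|x| <= 2 -> v 0 x = 1) (v_zero : forall x : R, 6 < `|x| -> v 0 x = 0).

(** The [k]-th derivative of [t |-> v 0 (t / m)]. For [m = 0] the inverse is 0 and the function is
    constant, so smoothness holds for every [m]. *)
Let scaled (m : nat) : 'I_d -> nat -> R -> R := fun j k t => (m%:R^-1 : R) ^+ k * v k (m%:R^-1 * t).

Let H_gt0 : 0 < H. Proof. exact: lt_le_trans H_ge1. Qed.

Let norm_scaled (m : nat) (t : R) : `|m%:R^-1 * t| = `|t| / m%:R.
Proof. by rewrite normrM normfV normr_nat mulrC. Qed.

Definition cutoff (m : nat) : cfun R d := tensor (scaled m) [::].

Let dscaled m j k (t : R) : is_derive t (1 : R) (scaled m j k) (scaled m j k.+1 t).
Proof.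
set c : R := m%:R^-1.
have h : is_derive t (1 : R) (fun s : R => c * s) c.
  rewrite -[c in is_derive _ _ _ c]mulr1; exact: (@is_deriveZ _ _ _ id c t 1 1 (is_derive_id _ _)).
have h2 := @is_derive1_comp R (v k) (fun s => c * s) t _ _ (dv k (c * t)) h.
rewrite (_ : scaled m j k = (c ^+ k) \*: (v k \o (fun s => c * s)))//.
have -> : scaled m j k.+1 t = c ^+ k *: (v k.+1 (c * t) * c).
  by rewrite /scaled /GRing.scale /= -/c exprSr; ring.
exact: is_deriveZ.
Qed.

Lemma smooth_cutoff m : smooth (cutoff m).
Proof. exact: (smooth_tensor (dscaled m)).1. Qed.

Let prod_M (k : 'I_d -> nat) : \prod_j M (k j) <= M (\sum_j k j)%N.
Proof.
suff [] : 0 <= \prod_j M (k j) /\ \prod_j M (k j) <= M (\sum_j k j)%N by [].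
elim/big_ind2 : _ => [|x n y n' [x0 xn] [y0 yn]|j _]; last by split => //; exact: ltW.
  by rewrite M_0.
split; first exact: mulr_ge0.
by apply: le_trans (M_supermul _ _); exact: ler_pM.
Qed.

(** Dilation multiplies the [k]-th derivative by [m ^- k], at most 1, so one bound serves all [m].
    The product of the [M k] over the coordinates is merged by supermultiplicativity. *)
Lemma cutoff_bound m : (0 < m)%N -> word_bound setT (roumieu_weight 1 H) (cutoff m).
Proof.
move=> m0 s x _; rewrite /cutoff (smooth_tensor (dscaled m)).2 cmod_real normr_prod.
rewrite /roumieu_weight mul1r.
have -> : size s = (\sum_(j < d) count_mem j s)%N.
  rewrite (perm_size (perm_word_of s)) size_word_of.
  by apply: eq_bigr => j _; rewrite ffunE.
apply: (@le_trans _ _ (\prod_j (H ^+ (count_mem j s) * M (count_mem j s)))).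
  apply: ler_prod => j _; rewrite normr_ge0 /= /scaled normrM.
  apply: le_trans (v_bound _ (m%:R^-1 * x 0 j)); rewrite ler_piMl//.
  rewrite normrX normfV normr_nat exprn_ile1 ?invr_ge0//.
  by rewrite invf_le1 ?ler1n// ltr0n.
rewrite big_split /= prodrXr; apply: ler_wpM2l; last exact: prod_M.
by rewrite exprn_ge0// ltW.
Qed.

Lemma cutoff1 m x : (0 < m)%N -> `|x| <= 2 * m%:R -> cutoff m x = 1.
Proof.
move=> m0 xm; rewrite /cutoff /tensor big1// => j _.
rewrite /scaled expr0 mul1r v_one//.
rewrite norm_scaled ler_pdivrMr ?ltr0n//.
exact: le_trans (coord_le_norm _ _) xm.
Qed.

Lemma cutoff0 m x : (0 < m)%N -> 6 * m%:R < `|x| -> cutoff m x = 0.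
Proof.
move=> m0 xm.
have [j hj] : exists j, 6 * m%:R < `|x 0 j|.
  apply: contrapT => /forallNP h; move: xm; apply/negP; rewrite -leNgt.
  apply: norm_leP => [|j]; first by rewrite mulr_ge0.
  by rewrite leNgt; apply/negP; exact: h.
rewrite /cutoff /tensor (bigD1 j)//= /scaled expr0 mul1r v_zero ?mul0r//.
by rewrite norm_scaled ltr_pdivlMr ?ltr0n.
Qed.

End Cutoff.

Lemma cutoffs_exist (A : R) : M3 A M -> exists (H : R) (chi : nat -> cfun R d),
  [/\ 1 <= H, forall m, smooth (chi m),
      forall m, (0 < m)%N -> word_bound setT (roumieu_weight 1 H) (chi m),
      forall m x, (0 < m)%N -> `|x| <= 2 * m%:R -> chi m x = 1 &
      forall m x, (0 < m)%N -> 6 * m%:R < `|x| -> chi m x = 0].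
Proof.
move=> m3; have [H [v [H1 dv vb v1 v0]]] := cutoff1_exists M_gt0 M_0 m3.
exists H, (cutoff v); split => //.
- exact: smooth_cutoff.
- exact: cutoff_bound.
- exact: cutoff1.
- exact: cutoff0.
Qed.

End TestFunctions.

(** * Ultradistributions vanishing at infinity *)

Section Equivalences.
Variables (R : realType) (d : nat) (M : nat -> R) (T : cfun R d -> R[i]).
Hypotheses (M_gt0 : forall p, 0 < M p) (M_0 : M 0 = 1)
  (M_supermul : forall i j, M i * M j <= M (i + j)%N)
  (T_ultra : ultradistribution M T).
Variables (H : R) (chi : nat -> cfun R d).
Hypotheses (H_ge1 : 1 <= H) (chi_smooth : forall m, smooth (chi m))
  (chi_bound : forall m, (0 < m)%N -> word_bound setT (roumieu_weight M 1 H) (chi m))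
  (chi_1 : forall m (x : 'rV[R]_d), (0 < m)%N -> `|x| <= 2 * m%:R -> chi m x = 1)
  (chi_0 : forall m (x : 'rV[R]_d), (0 < m)%N -> 6 * m%:R < `|x| -> chi m x = 0).
Implicit Types (f g : cfun R d) (K : set 'rV[R]_d) (r : nat -> R) (x : 'rV[R]_d).

Notation weight := (roumieu_weight M).
Notation prod_weight A r := (fun p => A * (product_seq r p * M p)).

Let H_gt0 : 0 < H. Proof. exact: lt_le_trans H_ge1. Qed.

Let weight_le C C' h h' p : 0 <= C -> C <= C' -> 0 <= h -> h <= h' ->
  weight C h p <= weight C' h' p.
Proof. by move=> *; apply: roumieu_weight_le. Qed.

Lemma chi_test m : (0 < m)%N -> test_function M (chi m).
Proof.
move=> m0; apply/(test_functionP M_gt0); exists (6 * m)%N, 1, H; split => //.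
- by rewrite muln_gt0.
- by move=> x; rewrite natrM; exact: chi_0.
- exact: chi_bound.
Qed.

Lemma smooth_chi_mul m f : smooth f -> smooth (cmul (chi m) f).
Proof. by move=> sf; exact: (smooth_leibniz (chi_smooth m) sf).1. Qed.

Lemma chi_mul0 m f x : (0 < m)%N -> 6 * m%:R < `|x| -> cmul (chi m) f x = 0.
Proof. by move=> m0 mx; rewrite /cmul chi_0// mul0r. Qed.

Lemma chi_mul_bound m C h f K : (0 < m)%N -> 0 <= C -> 0 < h -> smooth f ->
  word_bound K (weight C h) f ->
  word_bound K (weight C (2 * Num.max H h)) (cmul (chi m) f).
Proof.
move=> m0 C0 h0 sf wf; rewrite -[C]mul1r.
by apply: word_bound_cmul_roumieu => // s x _; exact: chi_bound.
Qed.

Lemma chi_mul_test m C h f : (0 < m)%N -> 0 <= C -> 0 < h -> smooth f ->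
  word_bound setT (weight C h) f -> test_function M (cmul (chi m) f).
Proof.
move=> m0 C0 h0 sf wf; apply/(test_functionP M_gt0).
exists (6 * m)%N, C, (2 * Num.max H h); split.
- by rewrite muln_gt0.
- by split => //; rewrite mulr_gt0// lt_max h0 orbT.
- exact: smooth_chi_mul.
- by move=> x; rewrite natrM; exact: chi_mul0.
- exact: chi_mul_bound.
Qed.

Lemma T_lin (a : R[i]) f g : test_function M f -> test_function M g ->
  T (a *: f + g) = a * T f + T g.
Proof. by move=> tf tg; case: T_ultra => + _; apply. Qed.

Lemma T_0 : T 0 = 0.
Proof.
have t0 := @test_function0 R d M M_gt0.
have := T_lin 1 t0 t0; rewrite scale1r addr0 mul1r => h.
by apply: (addrI (T 0)); rewrite addr0 -h.
Qed.

Lemma T_D f g : test_function M f -> test_function M g -> T (f + g) = T f + T g.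
Proof. by move=> tf tg; rewrite -{1}[f]scale1r T_lin// mul1r. Qed.

Lemma T_Z (a : R[i]) f : test_function M f -> T (a *: f) = a * T f.
Proof.
move=> tf; rewrite -[a *: f]addr0 T_lin ?T_0 ?addr0//.
exact: test_function0.
Qed.

Lemma T_B f g : test_function M f -> test_function M g -> T (f - g) = T f - T g.
Proof.
by move=> tf tg; rewrite -scaleN1r addrC T_lin// mulN1r addrC.
Qed.

(** Continuity on an inductive limit means continuity on each step: the seminorm dominating [T] is
    bounded by a multiple of the norm of [D_Kh]. *)
Lemma T_bound_compact (m : nat) (h : R) : (0 < m)%N -> 0 < h ->
  exists2 B, 0 <= B & forall f C, 0 <= C -> smooth f ->
    (forall x, m%:R < `|x| -> f x = 0) -> word_bound setT (weight C h) f ->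
    cmod (T f) <= B * C.
Proof.
move=> m0 h0; have [_ [p [_ hp] Tp]] := T_ultra.
have Kr : regular_compact (cube m%:R : set 'rV[R]_d) by apply: cube_regular; rewrite ltr0n.
have [_ /(_ h h0) [_ [C0 hC0]]] := hp _ Kr.
exists `|C0| => // f C C_ge0 sf f0 wf.
have w0 p0 : 0 < h ^+ p0 * M p0 by exact: roumieu_weight_gt0.
have q_le : (q_norm M (cube m%:R) h f <= C%:E)%E.
  by apply/weighted_norm_leP => // s x _; exact: wf.
have Df : carrier (D_Kh M (cube m%:R) h) f.
  split; first by split => //; exact: zero_outside_supp.
  by apply: le_lt_trans q_le _; exact: ltry.
have Tf : carrier (D_space d M) f by exists (cube m%:R) => //; exists h => //; exact: Df.
apply: le_trans (Tp f Tf) _; rewrite -lee_fin.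
apply: le_trans (hC0 f Df) _; rewrite EFinM.
have q0 : (0 <= q_norm M (cube m%:R) h f)%E by exact: weighted_norm_ge0.
apply: (@le_trans _ _ (`|C0|%:E * q_norm M (cube m%:R) h f)%E).
  by apply: lee_wpmul2r => //; rewrite lee_fin ler_norm.
by apply: lee_wpmul2l.
Qed.

(* The bounds of (b) and (e), with the finite value of the norm as a parameter. *)
Definition continuous_off r (C : R) K := forall f A, test_function M f ->
  supp f `&` K = set0 -> 0 <= A -> word_bound setT (prod_weight A r) f ->
  cmod (T f) <= C * A.

Lemma continuous_offP r C K : classR r -> 0 <= C ->
  continuous_off r C K <-> forall f, test_function M f -> supp f `&` K = set0 ->
    ((cmod (T f))%:E <= C%:E * R_norm M r f)%E.
Proof.
move=> cr C0; split=> [h f tf fK|h f A tf fK A0 wf].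
  have [A [A0 -> wA]] := test_R_norm_fin M_gt0 cr tf.
  by rewrite -EFinM lee_fin; exact: h.
have sf := test_function_smooth M_gt0 tf.
rewrite -lee_fin EFinM; apply: le_trans (h f tf fK) _.
by apply: lee_wpmul2l; rewrite ?lee_fin//; exact: R_norm_le.
Qed.

(** * From a bound off a compact set to vanishing at infinity *)

Definition vanishing_at_infinity := exists r, classR r /\ forall eps : R, 0 < eps ->
  exists K, regular_compact K /\ continuous_off r eps K.

Lemma continuous_off_vanishing r C K0 : classR r -> 0 < C -> compact K0 ->
  continuous_off r C K0 -> vanishing_at_infinity.
Proof.
move=> cr C0 K0c hC; exists r; split => // eps eps0.
apply: contrapT => /forallNP hK.
have [m0 m00 Km0] := compact_sub_cube K0c.
(* Otherwise the cube of size [m] would be a suitable compact set for [eps]. *)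
have bad (m : nat) : (0 < m)%N -> exists f A, [/\ test_function M f,
    forall x, cube m%:R x -> f x = 0, 0 <= A, word_bound setT (prod_weight A r) f &
    eps * A < cmod (T f)].
  move=> mpos; apply: contrapT => nbad; apply: (hK (cube m%:R)); split.
    by apply: cube_regular; rewrite ltr0n.
  move=> f A tf fK A0 wf; rewrite leNgt; apply/negP => lt.
  by apply: nbad; exists f, A; split => // x xm; exact: zero_off_supp fK xm.
have w0 p : 0 <= product_seq r p * M p.
  by rewrite mulr_ge0 ?ltW//; apply/product_seq_gt0/classR_ge1.
(* Summands with disjoint supports: the norm stays at most [1 / eps] while the
value of [T] grows by one at each step. *)
have tower (N : nat) : exists S, [/\ test_function M S,
    forall x, cube (m0.+1)%:R x -> S x = 0,
    word_bound setT (prod_weight eps^-1 r) S & T S = N%:R].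
  elim: N => [|N [S [tS S0 wS TS]]].
    exists 0; split => //; [exact: test_function0| |exact: T_0].
    move=> s x _; rewrite wD0 ComplexField.Normc.normc0.
    by rewrite mulr_ge0// invr_ge0 ltW.
  have [m1 [_ [_ [m10 _ sS S1 _]]]] := (test_functionP M_gt0 S).1 tS.
  (* The new summand vanishes on a cube reaching strictly beyond the support of [S], so at every
     point the derivatives of one of the two vanish. The cube also contains the one of size [m0.+1],
     which keeps the sum away from [K0]. *)
  have [//|f [A [tf f0 A0 wf lt]]] := bad (maxn m1 m0.+1).+1.
  have sf := test_function_smooth M_gt0 tf.
  have Tf0 : 0 < cmod (T f) by apply: le_lt_trans lt; rewrite mulr_ge0// ltW.
  exists ((T f)^-1 *: f + S); split.
  - exact: test_function_lin.
  - move=> x xm; rewrite (_ : ((T f)^-1 *: f + S) x = (T f)^-1 * f x + S x)//.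
    rewrite S0// f0 ?mulr0 ?addr0//; apply: le_trans xm _.
    by rewrite ler_nat leqW// leq_maxr.
  - move=> s x _; rewrite wDD// ?wDZ//; last exact: smoothZ.
    rewrite (_ : ((T f)^-1 *: wD s f + wD s S) x = (T f)^-1 * wD s f x + wD s S x)//.
    have [xm|xm] := ltP `|x| ((maxn m1 m0.+1).+1%:R : R).
      by rewrite (wD_inside s f0 xm) mulr0 add0r; exact: wS.
    rewrite (wD_outside s S1) ?addr0; last first.
      by apply: lt_le_trans xm; rewrite ltr_nat ltnS leq_maxl.
    rewrite ComplexField.Normc.normcM ComplexField.Normc.normcV.
    rewrite mulrC ler_pdivrMr//; apply: le_trans (wf s x I) _.
    rewrite mulrAC; apply: ler_wpM2r => //.
    by rewrite mulrC ler_pdivlMr// mulrC ltW.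
  - rewrite T_lin// TS mulVf ?nat1r// ?natr1//.
    by apply/negP => /eqP e; move: Tf0; rewrite e ComplexField.Normc.normc0 ltxx.
have [N hN] : exists N : nat, C * eps^-1 < N%:R.
  by exists (Num.truncn (C * eps^-1)).+1; rewrite truncnS_gt.
have [S [tS S0 wS TS]] := tower N.
have SK : supp S `&` K0 = set0.
  by apply: supp_disjoint Km0 _ S0; rewrite ltr_nat.
have e0 : 0 <= eps^-1 by rewrite invr_ge0 ltW.
have := hC S eps^-1 tS SK e0 wS; rewrite TS.
rewrite (_ : cmod N%:R = N%:R) ?leNgt ?hN//.
have -> : (N%:R : R[i]) = (N%:R +i* 0)%C.
  by rewrite -[RHS]/(real_complex R N%:R) rmorph_nat.
by rewrite cmod_real normr_nat.
Qed.

(** * Smallness far away on Roumieu balls *)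

Definition tail_small := forall h C eps : R, 0 < h -> 0 <= C -> 0 < eps ->
  exists2 m : nat, (0 < m)%N & forall f, test_function M f ->
    word_bound setT (weight C h) f -> (forall x, cube m%:R x -> f x = 0) ->
    cmod (T f) <= eps.

Lemma weight_le_product C h r : 0 <= C -> 0 < h -> classR r ->
  exists2 C', 0 <= C' & forall p, weight C h p <= prod_weight C' r p.
Proof.
move=> C0 h0 cr; have [B B0 hB] := geometric_le_product_seq cr h0.
exists (C * B); first by rewrite mulr_ge0// ltW.
move=> p; rewrite /roumieu_weight -mulrA; apply: ler_wpM2l => //.
by rewrite mulrA; apply: ler_wpM2r => //; exact: ltW.
Qed.

(** A Roumieu ball lies in a multiple [C'] of the unit ball for [r]. The cube obtained depends on
    [C] and [h]. *)
Lemma vanishing_tail_small : vanishing_at_infinity -> tail_small.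
Proof.
move=> [r [cr hr]] h C eps h0 C0 eps0.
have [C' C'0 hC'] := weight_le_product C0 h0 cr.
(* [C'] may be zero, hence the denominator [C' + 1]. *)
have e0 : 0 < eps / (C' + 1) by rewrite divr_gt0//; lra.
have [K [[Kc _ _ _] hK]] := hr _ e0.
have [m m0 Km] := compact_sub_cube Kc.
exists m.+1 => // f tf wf f0.
have fK : supp f `&` K = set0 by apply: supp_disjoint Km _ f0; rewrite ltr_nat.
apply: le_trans (hK f C' tf fK C'0 (word_bound_le hC' wf)) _.
have -> : eps / (C' + 1) * C' = eps * (C' / (C' + 1)) by ring.
by rewrite ler_piMr ?ltW// ltr_pdivrMr; lra.
Qed.

(** The radii of balls in [R[i]^o] are elements of [R[i]]; a positive one is real. *)
Lemma cauchy_complexP (u : nat -> R[i]) :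
  cauchy ((fun n => u n : R[i]^o) @ \oo) <->
  forall eps : R, 0 < eps -> exists N, forall m n, (N <= m)%N -> (N <= n)%N ->
    cmod (u m - u n) <= eps.
Proof.
split=> [/cauchy_ballP cu eps eps0|hu].
- have e0 : 0 < (eps%:C)%C by rewrite ltcR.
  have [[A B] /= [[N1 _ hA] [N2 _ hB]] AB] := cu _ e0.
  exists (maxn N1 N2) => m n Nm Nn.
  have := AB (u m, u n) _; rewrite -ball_normE /= ltcR => h; apply/ltW/h.
  split => /=; [apply: hA|apply: hB] => /=.
    exact: leq_trans (leq_maxl _ _) Nm.
  exact: leq_trans (leq_maxr _ _) Nn.
- apply/cauchy_ballP => e e0.
  have eE : e = ((complex.Re e)%:C)%C by rewrite RRe_real// gtr0_real.
  have er0 : 0 < complex.Re e by rewrite -ltcR -eE.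
  have [|N hN] := hu (complex.Re e / 2); first by rewrite divr_gt0.
  exists ([set z | exists2 n, (N <= n)%N & u n = z], [set z | exists2 n, (N <= n)%N & u n = z]).
    by split; exists N => // n Nn /=; exists n.
  move=> [_ _] [[m Nm <-] [n Nn <-]]; rewrite -ball_normE /= eE ltcR.
  by apply: le_lt_trans (hN m n Nm Nn) _; lra.
Qed.

Lemma cochi_bound m : (0 < m)%N -> word_bound setT (weight 2 H) ((fun=> 1) - chi m).
Proof.
move=> m0; apply: word_bound_le (word_boundB (smooth_cst _) (chi_smooth m)
  (word_bound_cst1 (d := d) M_gt0 M_0) (chi_bound m0)) => p.
rewrite [leRHS](_ : _ = weight 1 H p + weight 1 H p); last by rewrite /roumieu_weight; ring.
by rewrite lerD2r; apply: weight_le => //; exact: ler01.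
Qed.

Lemma cochi_smooth m : smooth ((fun=> 1) - chi m).
Proof. by apply: smoothB => //; exact: smooth_cst. Qed.

Lemma chi_split m f : f = cmul (chi m) f + cmul ((fun=> 1) - chi m) f.
Proof.
apply/funext => x; rewrite (_ : (cmul (chi m) f + cmul ((fun=> 1) - chi m) f) x =
  chi m x * f x + (1 - chi m x) * f x)//.
by rewrite -mulrDl addrC subrK mul1r.
Qed.

Lemma cochi_mul0 m f x : (0 < m)%N -> `|x| <= 2 * m%:R -> cmul ((fun=> 1) - chi m) f x = 0.
Proof.
move=> m0 xm; rewrite /cmul (_ : ((fun=> 1) - chi m) x = 1 - chi m x)//.
by rewrite chi_1// subrr mul0r.
Qed.

Lemma R_norm_sup_bound (P : nat -> cfun R d) r : classR r -> (forall n, smooth (P n)) ->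
  (ereal_sup (range (fun n => R_norm M r (P n))) < +oo)%E ->
  exists2 A, 0 <= A & forall n, word_bound setT (prod_weight A r) (P n).
Proof.
move=> cr sP; set s := ereal_sup _ => sfin.
have w0 p : 0 < product_seq r p * M p.
  by rewrite mulr_gt0//; apply/product_seq_gt0/classR_ge1.
have ub n : (R_norm M r (P n) <= s)%E by apply: ereal_sup_ubound; exists n.
have s0 : (0 <= s)%E by apply: le_trans (ub 0%N); exact: weighted_norm_ge0.
case: s sfin s0 ub => [A| |]// _ A0 ub; exists A => // n.
by apply/weighted_norm_leP => //; exact: ub.
Qed.

(** Bounds on a cube containing the support of [chi m] suffice. For functions in [E_space] no more
    is available, since there [h] depends on the compact set. *)
Lemma chi_mul_test_on m C h f : (0 < m)%N -> 0 <= C -> 0 < h -> smooth f ->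
  word_bound (cube (6 * m.+1)%:R) (weight C h) f ->
  test_function M (cmul (chi m) f) /\
  word_bound setT (weight C (2 * Num.max H h)) (cmul (chi m) f).
Proof.
move=> m0 C0 h0 sf wf.
have f0 x : (6 * m)%:R < `|x| -> cmul (chi m) f x = 0 by rewrite natrM; exact: chi_mul0.
have h1 : 0 < 2 * Num.max H h by rewrite mulr_gt0// lt_max h0 orbT.
have wb : word_bound setT (weight C (2 * Num.max H h)) (cmul (chi m) f).
  move=> s x _; have [xm|xm] := leP `|x| ((6 * m.+1)%:R : R).
    exact: chi_mul_bound wf s x xm.
  rewrite (wD_outside s f0) ?ComplexField.Normc.normc0.
    by rewrite mulr_ge0// ltW// roumieu_weight_gt0.
  by apply: le_lt_trans xm; rewrite ler_nat leq_mul.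
split=> //; apply/(test_functionP M_gt0).
exists (6 * m)%N, C, (2 * Num.max H h); split => //.
- by rewrite muln_gt0.
- exact: smooth_chi_mul.
Qed.

Lemma E_space_mem C h f : 0 <= C -> 0 < h -> smooth f ->
  word_bound setT (weight C h) f -> carrier (E_space d M) f.
Proof.
move=> C0 h0 sf wf; rewrite /E_space /proj_lim /= => K rK; exists h => //; split=> //.
have w0 p : 0 < h ^+ p * M p by exact: roumieu_weight_gt0.
apply: (@le_lt_trans _ _ C%:E); last exact: ltry.
by apply/weighted_norm_leP => // s x _; exact: wf.
Qed.

Lemma E_space_cst1 : carrier (E_space d M) ((fun=> 1) : cfun R d).
Proof.
apply: (@E_space_mem 1 1) => //; first exact: smooth_cst.
exact: word_bound_cst1.
Qed.

Lemma E_space_test f : test_function M f -> carrier (E_space d M) f.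
Proof.
move=> /(test_functionP M_gt0)[m [C [h [m0 [C0 h0] sf _ wf]]]].
exact: E_space_mem wf.
Qed.

(* A single compact set, containing the support of [chi m], is enough in the
projective limit. *)
Lemma cseminorm_chi m : (0 < m)%N ->
  cseminorm (E_space d M) (fun f => cmod (T (cmul (chi m) f))).
Proof.
move=> m0; set K := cube (6 * m.+1)%:R : set 'rV[R]_d.
have Kr : regular_compact K by apply: cube_regular; rewrite ltr0n.
pose F := \bigcup_(h in [set h : R | 0 < h]) carrier (@E_Kh R d M K h).
have tF f : F f -> test_function M (cmul (chi m) f).
  move=> [h /= h0 [sf fq]].
  have w0 p : 0 < h ^+ p * M p by exact: roumieu_weight_gt0.
  have [C [C0 _ wf]] := weighted_norm_fin w0 sf fq.
  exact: (chi_mul_test_on m0 C0 h0 sf wf).1.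
have semi (G : set (cfun R d)) : G `<=` F -> seminorm_on G (fun f => cmod (T (cmul (chi m) f))).
  move=> GF; split => [f _|a f Gf|f g Gf Gg]; first exact: cmod_ge0.
  - rewrite (_ : cmul (chi m) (a *: f) = a *: cmul (chi m) f); last first.
      by apply/funext => x; rewrite /cmul /GRing.scale /= mulrCA.
    by rewrite T_Z ?ComplexField.Normc.normcM//; exact/tF/GF.
  - rewrite (_ : cmul (chi m) (f + g) = cmul (chi m) f + cmul (chi m) g); last first.
      by apply/funext => x; rewrite /cmul mulrDr.
    by rewrite T_D ?cmodD//; exact/tF/GF.
split.
  by apply: semi => f Ef; exact: Ef K Kr.
exists 1%N, (fun=> K), (fun _ f => cmod (T (cmul (chi m) f))); split; last first.
  by move=> f _; rewrite big_ord1.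
move=> _; split=> //; split; first exact: semi.
move=> h /= h0; split; first by apply: semi => f Ef; exists h.
have h1 : 0 < 2 * Num.max H h by rewrite mulr_gt0// lt_max h0 orbT.
have [|B B0 hB] := @T_bound_compact (6 * m)%N _ _ h1; first by rewrite muln_gt0.
exists B => f [sf fq].
have w0 p : 0 < h ^+ p * M p by exact: roumieu_weight_gt0.
have [C [C0 E wf]] := weighted_norm_fin w0 sf fq.
rewrite /q_norm E -EFinM lee_fin; apply: hB => //.
- exact: smooth_chi_mul.
- by move=> x; rewrite natrM; exact: chi_mul0.
- exact: (chi_mul_test_on m0 C0 h0 sf wf).2.
Qed.

Lemma vanishing_cauchy : vanishing_at_infinity ->
  forall P, approximate_unit M P -> cauchy ((fun n => T (P n) : R[i]^o) @ \oo).
Proof.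
move=> [r [cr hr]] P [tP [_ _ cP] bP]; apply/cauchy_complexP => eps eps0.
(* The Leibniz rule costs [2 ^+ p]: both factors are bounded for the smaller sequence [r'], so that
   their product obeys a bound for [r]. *)
have [r' [cr' [C2 C20 hC2]]] := classR_half cr.
have sP n := test_function_smooth M_gt0 (tP n).
have [A A0 hA] := R_norm_sup_bound cr' sP (bP r' cr').
have [C1 C10 hC1] := @weight_le_product 2 H r' (ler0n R 2) H_gt0 cr'.
pose A' := C1 * A * C2.
have A'0 : 0 <= A' by rewrite !mulr_ge0// ltW.
have e0 : 0 < eps / (4 * (A' + 1)) by rewrite divr_gt0// mulr_gt0//; lra.
have [K [[Kc _ _ _] hK]] := hr _ e0.
have [m m0 Km] := compact_sub_cube Kc.
have tchi n : test_function M (cmul (chi m) (P n)).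
  have [m' [C [h [_ [C0 h0] sf _ wf]]]] := (test_functionP M_gt0 _).1 (tP n).
  exact: chi_mul_test wf.
have cochiE n : cmul ((fun=> 1) - chi m) (P n) = P n - cmul (chi m) (P n).
  by apply/esym; rewrite [X in X - _ = _](chi_split m (P n)) addrAC subrr add0r.
have tcochi n : test_function M (cmul ((fun=> 1) - chi m) (P n)).
  by rewrite cochiE; exact: test_functionB.
have far n : cmod (T (cmul ((fun=> 1) - chi m) (P n))) <= eps / 4.
  have zK : supp (cmul ((fun=> 1) - chi m) (P n)) `&` K = set0.
    apply: (@supp_disjoint _ _ m%:R (2 * m%:R)) => //.
      by rewrite ltr_pMl ?ltr0n// ltr1n.
    by move=> x xm; exact: cochi_mul0.
  apply: le_trans (hK _ A' (tcochi n) zK A'0 _) _.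
    apply: word_bound_le (word_bound_cmul_product M_gt0 M_supermul (cochi_smooth m) (sP n) cr' C10 A0
      (word_bound_le hC1 (cochi_bound m0)) (hA n)) => p.
    rewrite mulrCA /A' -mulrA; apply: ler_wpM2l; first exact: mulr_ge0.
    rewrite !mulrA; apply: ler_wpM2r; first exact: ltW.
    exact: hC2.
  have -> : eps / (4 * (A' + 1)) * A' = eps / 4 * (A' / (A' + 1)) by field; lra.
  rewrite ler_piMr//; first by lra.
  by rewrite ler_pdivrMr; lra.
have e4 : 0 < eps / 4 by lra.
have /cvgrPdist_le /(_ _ e4) [N _ hN] := cP _ (cseminorm_chi m0).
have near n : (N <= n)%N -> cmod (T (cmul (chi m) (P n)) - T (chi m)) <= eps / 4.
  move=> Nn; have := hN n Nn; rewrite sub0r normrN ger0_norm; last exact: cmod_ge0.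
  rewrite -T_B//; last exact: chi_test.
  congr (cmod (T _) <= _); apply/funext => x.
  by rewrite /cmul (_ : (P n - (fun=> 1)) x = P n x - 1)// mulrBr mulr1.
exists N => n k Nn Nk.
rewrite (chi_split m (P n)) (chi_split m (P k)) !T_D//.
set a := T (cmul (chi m) (P n)); set b := T (cmul (chi m) (P k)).
set a' := T (cmul _ (P n)); set b' := T (cmul _ (P k)).
have -> : a + a' - (b + b') = ((a - T (chi m)) - (b - T (chi m))) + (a' - b') by ring.
apply: le_trans (cmodD _ _) _.
have h1 := cmodB (a - T (chi m)) (b - T (chi m)); have h2 := cmodB a' b'.
have := near n Nn; have := near k Nk; have := far n; have := far k.
rewrite -/a -/b -/a' -/b'; lra.
Qed.

Lemma special_tail_small :
  (forall P, special_approximate_unit M P -> cauchy ((fun n => T (P n) : R[i]^o) @ \oo)) ->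
  tail_small.
Proof.
move=> hd h C eps h0 C0 eps0; apply: contrapT => hN.
have bad (m : nat) : exists f, [/\ test_function M f, word_bound setT (weight C h) f,
    forall x, cube m.+1%:R x -> f x = 0 & eps < cmod (T f)].
  apply: contrapT => nb; apply: hN; exists m.+1 => // f tf wf f0.
  by rewrite leNgt; apply/negP => lt; apply: nb; exists f.
pose F k : cfun R d := proj1_sig (cid (bad k)).
have hF k : [/\ test_function M (F k), word_bound setT (weight C h) (F k),
    forall x, cube k.+1%:R x -> F k x = 0 & eps < cmod (T (F k))].
  exact: proj2_sig (cid (bad k)).
(* The terms of index [2N] and [2N + 1] share the same cutoff and differ by [F N], so the Cauchy
   property would force [|T (F N)| <= eps]. *)
pose P n : cfun R d := ((odd n)%:R : R[i]) *: F n./2 + chi (n./2).+1.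
have h'0 : 0 < Num.max H h by rewrite lt_max h0 orbT.
have tP n : test_function M (P n).
  have [tF _ _ _] := hF n./2.
  by apply: test_function_lin => //; exact: chi_test.
have sP n := test_function_smooth M_gt0 (tP n).
have wP n : word_bound setT (weight (C + 1) (Num.max H h)) (P n).
  have [tF wF _ _] := hF n./2; have sF := test_function_smooth M_gt0 tF.
  apply: word_bound_le (word_boundD (smoothZ _ sF) (chi_smooth _)
    (word_boundZ _ sF wF) (chi_bound (ltn0Sn n./2))) => p.
  rewrite [leRHS]mulrDl; apply: lerD; last first.
    by apply: weight_le; rewrite ?ler01 ?le_max ?lexx ?(ltW H_gt0)//; lra.
  apply: (@le_trans _ _ (weight C h p)).
    have w0 : 0 <= weight C h p by rewrite mulr_ge0// ltW// roumieu_weight_gt0.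
    by case: (odd n); rewrite ?ComplexField.Normc.normc1 ?ComplexField.Normc.normc0 ?mul1r ?mul0r.
  by apply: weight_le; rewrite ?le_max ?lexx ?orbT// ltW.
have P1 n x : `|x| <= (n./2).+1%:R -> P n x = 1.
  move=> xn; have [_ _ F0 _] := hF n./2.
  rewrite (_ : P n x = (odd n)%:R * F n./2 x + chi (n./2).+1 x)//.
  rewrite F0// mulr0 add0r chi_1//; apply: le_trans xn _.
  by rewrite ler_peMl// ler1n.
have C1 : 0 <= C + 1 by lra.
have aP : approximate_unit M P.
  split=> //.
  - split=> [n| |p [[p0 _ _] [n [K [q [hq pq]]]]]]; [exact: E_space_test|exact: E_space_cst1|].
    have Kc j : exists2 m : nat, (0 < m)%N & K j `<=` cube m%:R.
      by have [[cK _ _ _] _] := hq j; exact: compact_sub_cube.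
    pose mm j := sval (cid2 (Kc j)).
    have hmm j : K j `<=` cube (mm j)%:R by exact: (svalP (cid2 (Kc j))).2.
    (* From this index on, [P k] equals 1 near each of the finitely many compact sets entering the
       seminorm, which therefore vanishes on [P k - 1]. *)
    apply/cvgrPdist_le => e e0; exists (2 * \max_j mm j)%N => // k /= Nk.
    have s1 : smooth (P k - (fun=> 1)) by apply: smoothB => //; exact: smooth_cst.
    have z x : `|x| <= (k./2).+1%:R -> (P k - (fun=> 1)) x = 0.
      by move=> xk; rewrite (_ : (P k - (fun=> 1)) x = P k x - 1)// P1// subrr.
    have q_le j : q j (P k - (fun=> 1)) <= 0.
      have [_ [_ /(_ (Num.max H h) h'0)[_ [B hB]]]] := hq j.
      have w0 p1 : 0 < Num.max H h ^+ p1 * M p1 by exact: roumieu_weight_gt0.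
      have n0 : q_norm M (K j) (Num.max H h) (P k - (fun=> 1)) = 0%E.
        apply/eqP; rewrite eq_le; apply/andP; split; last exact: weighted_norm_ge0.
        apply/weighted_norm_leP => // s x /hmm xm.
        rewrite (wD_inside s z) ?ComplexField.Normc.normc0 ?mul0r//.
        apply: le_lt_trans xm _; rewrite ltr_nat ltnS.
        apply: leq_trans (leq_bigmax j) _.
        by rewrite -(doubleK (\max_j mm j)) -mul2n; exact: half_leq.
      have := hB (P k - (fun=> 1)); rewrite n0 mule0 lee_fin; apply.
      by split=> //; rewrite n0; exact: ltry.
    have EP : carrier (E_space d M) (P k - (fun=> 1)).
      apply: (@E_space_mem (C + 1 + 1) (Num.max H h)) => //; first by lra.
      apply: word_bound_le (word_boundB (sP k) (smooth_cst _) (wP k)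
        (word_bound_cst1 (d := d) M_gt0 M_0)) => p1.
      rewrite [leRHS]mulrDl lerD2l; apply: weight_le; rewrite ?ler01//.
      by rewrite le_max; apply/orP; left.
    rewrite sub0r normrN ger0_norm; last exact: p0.
    apply: le_trans (pq _ EP) _; apply: le_trans (ltW e0).
    by apply: sumr_le0 => j _; exact: q_le.
  - move=> r cr; have [B B0 hB] := weight_le_product C1 h'0 cr.
    apply: (@le_lt_trans _ _ B%:E); last exact: ltry.
    apply: ge_ereal_sup => _ [n _ <-]; apply: R_norm_le => //.
    exact: word_bound_le hB (wP n).
have /cauchy_complexP /(_ _ eps0)[N hN'] : cauchy ((fun n => T (P n) : R[i]^o) @ \oo).
  apply: hd; split=> // K cK; have [m m0 Km] := compact_sub_cube cK.
  exists (2 * m)%N => n x mn /Km xm; apply: P1; apply: le_trans xm _.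
  by rewrite ler_nat leqW// -(doubleK m) -mul2n; exact: half_leq.
have [tF _ _ ] := hF N; rewrite ltNge => /negP; apply.
have NN : (N <= N.*2)%N by rewrite -addnn leq_addr.
have := hN' (N.*2).+1 N.*2 (leqW NN) NN.
rewrite -T_B// /P /= odd_double doubleK uphalf_double /= scale1r scale0r add0r.
by rewrite addrK.
Qed.

(** * Eventual bounds of [T] on functions without compact support *)

Definition eventually_le f (c : R) := exists m0 : nat, forall m, (m0 <= m)%N -> (0 < m)%N ->
  cmod (T (cmul (chi m) f)) <= c.

(** Both cutoffs equal 1 on the cube of size [m0], so the difference of the two products vanishes
    there; it stays in one Roumieu ball because the bounds of [chi m] do not depend on [m]. *)
Lemma tail_uniform C h eps : tail_small -> 0 <= C -> 0 < h -> 0 < eps ->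
  exists2 m0 : nat, (0 < m0)%N & forall f, smooth f -> word_bound setT (weight C h) f ->
    forall m, (m0 <= m)%N ->
      cmod (T (cmul (chi m) f) - T (cmul (chi m0) f)) <= eps.
Proof.
move=> ts C0 h0 eps0.
have h1 : 0 < 2 * Num.max H h by rewrite mulr_gt0// lt_max h0 orbT.
have C2 : 0 <= C + C by exact: addr_ge0.
have [m0 m0_gt0 hm] := ts _ _ _ h1 C2 eps0.
exists m0 => // f sf wf m mm; have m_gt0 := leq_trans m0_gt0 mm.
have t1 := chi_mul_test m_gt0 C0 h0 sf wf; have t2 := chi_mul_test m0_gt0 C0 h0 sf wf.
rewrite -T_B//; apply: hm.
- exact: test_functionB.
- apply: word_bound_le (word_boundB (smooth_chi_mul m sf) (smooth_chi_mul m0 sf)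
    (chi_mul_bound m_gt0 C0 h0 sf wf) (chi_mul_bound m0_gt0 C0 h0 sf wf)) => p.
  by rewrite [leRHS]mulrDl.
- move=> x xm; have m01 : (1 : R) <= m0%:R by rewrite ler1n.
  have mm1 : m0%:R <= m%:R :> R by rewrite ler_nat.
  rewrite (_ : (_ - _) x = chi m x * f x - chi m0 x * f x)// !chi_1// ?subrr//.
    by move: xm; rewrite /cube /=; lra.
  by move: xm; rewrite /cube /=; lra.
Qed.

Lemma tail_bounded C h : tail_small -> 0 <= C -> 0 < h -> exists2 c, 0 <= c &
  forall f, smooth f -> word_bound setT (weight C h) f -> eventually_le f c.
Proof.
move=> ts C0 h0; have [m0 m0_gt0 hm] := tail_uniform ts C0 h0 ltr01.
have h1 : 0 < 2 * Num.max H h by rewrite mulr_gt0// lt_max h0 orbT.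
have [|B B0 hB] := @T_bound_compact (6 * m0)%N _ _ h1; first by rewrite muln_gt0.
exists (B * C + 1); first by rewrite addr_ge0// mulr_ge0.
move=> f sf wf; exists m0 => m mm _.
have h3 : cmod (T (cmul (chi m0) f)) <= B * C.
  apply: hB => //; [exact: smooth_chi_mul| |exact: chi_mul_bound].
  by move=> x; rewrite natrM; exact: chi_mul0.
have := cmodD (T (cmul (chi m) f) - T (cmul (chi m0) f)) (T (cmul (chi m0) f)).
by rewrite subrK; have := hm f sf wf m mm; lra.
Qed.

(** On a Roumieu ball, [f |-> T (chi m f)] is continuous for the convergence of all derivatives. The
    finitely many derivatives of low order become uniformly small on a cube; the high orders become
    small when [h] is doubled, as [C <= delta * 2 ^+ p] from [p0] on. *)
Lemma limit_small (F : set_system nat) (FF : Filter F) (psi : nat -> cfun R d)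
    m C h eps : (0 < m)%N -> 0 <= C -> 0 < h -> 0 < eps ->
  (forall n, smooth (psi n)) -> (forall n, word_bound setT (weight C h) (psi n)) ->
  (forall s x, (fun n => complex.Re (wD s (psi n) x)) @ F --> (0 : R)) ->
  (forall s x, (fun n => complex.Im (wD s (psi n) x)) @ F --> (0 : R)) ->
  \forall n \near F, cmod (T (cmul (chi m) (psi n))) <= eps.
Proof.
move=> m0 C0 h0 eps0 spsi wpsi re0 im0.
pose mx := Num.max H h; have mx0 : 0 < mx by rewrite lt_max h0 orbT.
(* One factor 2 pays for the Leibniz rule, the other for the high orders. *)
have h2 : 0 < 4 * mx by rewrite mulr_gt0.
have [|B B0 hB] := @T_bound_compact (6 * m)%N _ _ h2; first by rewrite muln_gt0.
pose delta := eps / (2 * (B + 1)).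
have d0 : 0 < delta by rewrite divr_gt0// mulr_gt0//; lra.
have [p0 hp0] : exists p0 : nat, forall p, (p0 <= p)%N -> C <= delta * 2 ^+ p.
  exists (Num.truncn (C / delta)).+1 => p hp.
  rewrite mulrC -ler_pdivrMr//; apply: le_trans (ltW (truncnS_gt _)) _.
  rewrite -natrX ler_nat; apply: leq_trans hp _; exact/ltnW/ltn_expl.
have cK := @cube_compact R d (6 * m.+1)%:R.
have unif (s : seq 'I_d) (e : R) : 0 < e -> \forall n \near F, forall x,
    cube (6 * m.+1)%:R x -> cmod (wD s (psi n) x) <= e.
  move=> e0; have e20 : 0 < e / 2 by lra.
  have lipR n x y : `|re_part (wD s (psi n)) x - re_part (wD s (psi n)) y| <=
      d%:R * weight C h (size s).+1 * `|x - y|.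
    apply: (@partial_bound_lipschitz _ _ _ (fun j => re_part (wD (j :: s) (psi n)))) => j z.
      exact: (smooth_has_partial s j (spsi n) z).1.
    by apply: le_trans (Re_le_cmod _) _; exact: wpsi.
  have lipI n x y : `|im_part (wD s (psi n)) x - im_part (wD s (psi n)) y| <=
      d%:R * weight C h (size s).+1 * `|x - y|.
    apply: (@partial_bound_lipschitz _ _ _ (fun j => im_part (wD (j :: s) (psi n)))) => j z.
      exact: (smooth_has_partial s j (spsi n) z).2.
    by apply: le_trans (Im_le_cmod _) _; exact: wpsi.
  have uR := cvg_uniform_on_compact FF cK lipR (re0 s) e20.
  have uI := cvg_uniform_on_compact FF cK lipI (im0 s) e20.
  apply: filterS2 uR uI => n nR nI x xK; apply: le_trans (cmod_le_ReIm _) _.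
  by have := nR x xK; have := nI x xK; rewrite /re_part /im_part; lra.
have unif_words (q : nat) (e : nat -> R) : (forall p, 0 < e p) ->
    \forall n \near F, forall s : seq 'I_d, (size s < q)%N ->
      forall x, cube (6 * m.+1)%:R x -> cmod (wD s (psi n) x) <= e (size s).
  move=> e0.
  have fin : \forall n \near F, forall k : 'I_q, forall t : k.-tuple 'I_d,
      forall x, cube (6 * m.+1)%:R x -> cmod (wD t (psi n) x) <= e k.
    apply: filter_forall => k; apply: filter_forall => t; exact: unif.
  apply: filterS fin => n hn s sq x xK.
  exact: (hn (Ordinal sq) (in_tuple s) x xK).
pose d3 := Num.min delta 1.
have d30 : 0 < d3 by rewrite lt_min d0 ltr01.
have wp p : 0 < d3 * (h ^+ p * M p) by rewrite mulr_gt0// roumieu_weight_gt0.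
apply: filterS (unif_words p0 (fun p => d3 * (h ^+ p * M p)) wp) => n hn.
have Mpow p : 0 < mx ^+ p * M p by exact: roumieu_weight_gt0.
(* [b] bounds the derivatives of [psi n], and [c] those of the product before the Leibniz factor. A
   derivative of the product of order at least [p0] may involve low or high orders of [psi n]; the
   constant [C + d3] covers both cases. *)
pose b p := if (p < p0)%N then weight d3 h p else weight C h p + weight d3 h p.
pose c p := if (p < p0)%N then weight d3 mx p else weight (C + d3) mx p.
have Cd0 : 0 <= C + d3 by lra.
have b_le i j : weight 1 H i * b j <= c (i + j)%N.
  have W E : 0 <= E -> weight 1 H i * weight E h j <= weight E mx (i + j).
    move=> E0; rewrite /roumieu_weight mul1r mulrCA; apply: ler_wpM2l => //.
    rewrite mulrACA exprD; apply: ler_pM => //.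
    - by rewrite mulr_ge0// exprn_ge0// ltW.
    - by rewrite mulr_ge0// ltW.
    - by apply: ler_pM; rewrite ?exprn_ge0 ?lerXn2r ?nnegrE ?le_max ?lexx ?orbT// ltW.
  rewrite /b /c; case: ltnP => jp; case: ltnP => ijp.
  - exact/W/ltW.
  - apply: le_trans (W _ (ltW d30)) _; apply: ler_wpM2r; first exact: ltW.
    by lra.
  - by have := leq_ltn_trans (leq_trans jp (leq_addl i j)) ijp; rewrite ltnn.
  - by rewrite -mulrDl; exact: W.
have mulb : word_bound setT (weight (delta + delta) (4 * mx)) (cmul (chi m) (psi n)).
  move=> s x _; have [xm|xm] := leP `|x| ((6 * m.+1)%:R : R); last first.
    rewrite (wD_outside (m := (6 * m)%:R) s) ?ComplexField.Normc.normc0.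
    - by rewrite mulr_ge0 ?addr_ge0 ?(ltW d0)// ltW// roumieu_weight_gt0.
    - by move=> y; rewrite natrM; exact: chi_mul0.
    - by apply: le_lt_trans xm; rewrite ler_nat leq_mul.
  apply: le_trans (wD_cmul_bound (x := x) (a := weight 1 H) (b := b) (c := c)
    (chi_smooth m) (spsi n) _ _ b_le s) _.
  - by move=> t; exact: chi_bound.
  - move=> t; rewrite /b; case: ltnP => tp; first exact: hn.
    apply: le_trans (wpsi n t x I) _; rewrite lerDl; exact/ltW/wp.
  set p := size s.
  have dd : d3 <= delta by rewrite ge_min lexx.
  have -> : weight (delta + delta) (4 * mx) p = 2 ^+ p * (2 ^+ p * (delta + delta) * (mx ^+ p * M p)).
    rewrite /roumieu_weight (_ : 4 * mx = 2 * (2 * mx)); last by ring.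
    by rewrite !exprMn; ring.
  apply: ler_wpM2l; first by rewrite exprn_ge0.
  have p21 : 1 <= 2 ^+ p :> R by apply: exprn_ege1; lra.
  have pd : delta <= 2 ^+ p * delta by rewrite ler_peMl// ltW.
  rewrite /c; case: ltnP => pp; apply: ler_wpM2r; rewrite ?(ltW (Mpow p))//.
    by rewrite mulrDr; lra.
  by rewrite mulrDr; have := hp0 p pp; rewrite mulrC; lra.
apply: le_trans (hB _ (delta + delta) _ (smooth_chi_mul m (spsi n)) _ mulb) _.
- by rewrite addr_ge0// ltW.
- by move=> x; rewrite natrM; exact: chi_mul0.
have -> : B * (delta + delta) = eps * (B / (B + 1)) by rewrite /delta; field; lra.
by rewrite ler_piMr ?ltW// ltr_pdivrMr; lra.
Qed.

(** * Enlarging the allowed growth of derivatives step by step *)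

Definition bump (N : nat) r : nat -> R := fun i => r i + (N < i)%:R.

Definition eventually_bounded r (c : R) := forall f, smooth f ->
  word_bound setT (fun p => product_seq r p * M p) f -> eventually_le f c.

Lemma product_seq_le_exp r (b : R) p : r 0 = 1 -> (forall i, 0 <= r i) ->
  (forall i, r i <= b) -> product_seq r p <= b ^+ p.
Proof.
move=> r0 rge rb; elim: p => [|p ih]; first by rewrite product_seq0.
rewrite product_seqS exprSr; apply: ler_pM => //.
by apply: prodr_ge0 => i _.
Qed.

(* One step of a Banach-Dieudonne argument: the balls obtained by relaxing the
bounds on the derivatives of order beyond [N] decrease, as [N] grows, to the
original one, and they are compact for the convergence of all derivatives. *)
Lemma eventually_bounded_bump r (b c eps : R) N0 : tail_small -> r 0 = 1 ->
  (forall i, 1 <= r i) -> (forall i, r i <= b) -> eventually_bounded r c -> 0 < eps ->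
  exists2 N : nat, (N0 <= N)%N & eventually_bounded (bump N r) (c + eps).
Proof.
move=> ts r0 r1 rb hr eps0; apply: contrapT => hN.
have bad k : exists f, [/\ smooth f,
    word_bound setT (fun p => product_seq (bump (N0 + k) r) p * M p) f &
    ~ eventually_le f (c + eps)].
  apply: contrapT => nb; apply: hN; exists (N0 + k)%N; first exact: leq_addr.
  by move=> f sf wf; apply: contrapT => ne; apply: nb; exists f.
pose phi k : cfun R d := proj1_sig (cid (bad k)).
have hphi k : [/\ smooth (phi k),
    word_bound setT (fun p => product_seq (bump (N0 + k) r) p * M p) (phi k) &
    ~ eventually_le (phi k) (c + eps)] by exact: proj2_sig (cid (bad k)).
have sphi k : smooth (phi k) by case: (hphi k).
pose h := b + 1.
have b1 : 1 <= b by rewrite -r0.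
have h0 : 0 < h by rewrite /h; lra.
have bump_le k p : product_seq (bump k r) p <= h ^+ p.
  apply: product_seq_le_exp => [|i|i].
  - by rewrite /bump ltn0 addr0.
  - by rewrite addr_ge0//; exact: le_trans (r1 i).
  - by rewrite /bump /h; apply: lerD => //; case: (k < i)%N.
have wphi k : word_bound setT (weight 1 h) (phi k).
  have [_ + _] := hphi k; apply: word_bound_le => p.
  by rewrite /roumieu_weight mul1r; apply: ler_wpM2r; [exact: ltW|exact: bump_le].
have [U [UU sU]] := @ultraFilterLemma nat \oo _.
have UP : ProperFilter U by exact: ultra_proper.
have UF : Filter U by exact: filter_filter.
have [f [sf lf]] := ultra_limit_smooth UU sphi (fun n s x => wphi n s x I).
(* For [k] at least the order of the derivative the bump lies beyond that order, so the limit obeys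
   the original bound. *)
have wf : word_bound setT (fun p => product_seq r p * M p) f.
  move=> s x _; apply/ler_addgt0Pr => e e0.
  have e20 : 0 < e / 2 by lra.
  have [/cvgrPdist_le /(_ _ e20) c1 /cvgrPdist_le /(_ _ e20) c2] := lf s x.
  have c3 : U [set k | (size s <= k)%N] by apply: sU; exists (size s).
  have [k [[k1 k2] /= k3]] := filter_ex (filterI (filterI c1 c2) c3).
  have [_ /(_ s x I) wk _] := hphi k.
  have E : product_seq (bump (N0 + k) r) (size s) = product_seq r (size s).
    apply: eq_big_nat => i /andP[_ is_]; rewrite /bump ltnNge.
    by rewrite (leq_trans _ (leq_addl N0 k)) ?addr0// (leq_trans _ k3).
  rewrite E in wk.
  rewrite -[wD s f x](subrK (wD s (phi k) x)) addrC.
  apply: le_trans (cmodD _ _) _; apply: lerD => //.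
  apply: le_trans (cmod_le_ReIm _) _.
  by rewrite ReD ImD ReN ImN; move: k1 k2 => /=; lra.
have wf1 : word_bound setT (weight 1 h) f.
  apply: word_bound_le wf => p; rewrite /roumieu_weight mul1r.
  apply: ler_wpM2r; first exact: ltW.
  apply: product_seq_le_exp => // i; first exact: le_trans (r1 i).
  by apply: le_trans (rb i) _; rewrite /h; lra.
have [m1 hm1] := hr f sf wf.
have spsi n : smooth (phi n - f) by exact: smoothB.
have wpsi n : word_bound setT (weight 2 h) (phi n - f).
  apply: word_bound_le (word_boundB (sphi n) sf (wphi n) wf1) => p.
  by rewrite -mulrDl.
have eps40 : 0 < eps / 4 by lra.
have two0 : (0 : R) <= 2 by [].
(* [m0] is fixed before [n]: [limit_small] handles one cutoff, and [tail_uniform] transfers the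
   smallness to all later ones. Each costs [eps / 4]. *)
have [m0 m0_gt0 hm0] := tail_uniform ts two0 h0 eps40.
have small : \forall n \near U, cmod (T (cmul (chi m0) (phi n - f))) <= eps / 4.
  apply: (limit_small UF m0_gt0 two0 h0 eps40 spsi wpsi) => s x.
  - have h1 := cvgB (lf s x).1 (@cvg_cst _ (complex.Re (wD s f x)) _ U UF).
    have {}h1 := h1 UF; rewrite subrr in h1; apply: cvg_trans h1; apply: near_eq_cvg; apply: nearW => n.
    by rewrite /= wDB// ReD ReN.
  - have h1 := cvgB (lf s x).2 (@cvg_cst _ (complex.Im (wD s f x)) _ U UF).
    have {}h1 := h1 UF; rewrite subrr in h1; apply: cvg_trans h1; apply: near_eq_cvg; apply: nearW => n.
    by rewrite /= wDB// ImD ImN.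
have [n hn] := filter_ex small.
have [_ _] := hphi n; apply; exists (maxn m0 m1) => m mm m_gt0.
have mm0 : (m0 <= m)%N by exact: leq_trans (leq_maxl _ _) mm.
have mm1 : (m1 <= m)%N by exact: leq_trans (leq_maxr _ _) mm.
have -> : cmul (chi m) (phi n) = cmul (chi m) f + cmul (chi m) (phi n - f).
  apply/funext => x; rewrite (_ : (_ + _) x = chi m x * f x + chi m x * (phi n x - f x))//.
  by rewrite -mulrDr addrC subrK.
have one0 : (0 : R) <= 1 by [].
rewrite T_D; [|exact: chi_mul_test wf1|exact: chi_mul_test (wpsi n)].
apply: le_trans (cmodD _ _) _.
have := hm1 m mm1 m_gt0; have := hm0 _ (spsi n) (wpsi n) m mm0.
have := cmodD (T (cmul (chi m) (phi n - f)) - T (cmul (chi m0) (phi n - f))) (T (cmul (chi m0) (phi n - f))).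
by rewrite subrK; lra.
Qed.

Lemma tail_small_continuous : tail_small -> exists r C, [/\ classR r, 0 < C &
  forall f A, test_function M f -> 0 <= A -> word_bound setT (prod_weight A r) f ->
    cmod (T f) <= C * A].
Proof.
move=> ts; have [c0 c0_ge0 hc0] := tail_bounded ts (@ler01 R) (@ltr01 R).
(* Step [n] may lose [2^-1 ^+ n.+1]; the bound starts at [c0] and stays below [c0 + 1]. *)
pose c n : R := c0 + 1 - 2^-1 ^+ n.
pose Inv n r := [/\ r 0 = 1, {homo r : i j / (i <= j)%N >-> i <= j},
  forall i, r i <= n.+1%:R & eventually_bounded r (c n)].
(* The premise [Inv] stands inside the existential so that [choice] gives a function on all
   pairs. *)
have stepP (nr : nat * (nat -> R)) : exists N, Inv nr.1 nr.2 ->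
    (nr.1 <= N)%N /\ Inv nr.1.+1 (bump N nr.2).
  case: nr => n r /=; have [inv|ninv] := pselect (Inv n r); last by exists 0%N.
  have [r0 hr rb er] := inv.
  have r1 i : 1 <= r i by rewrite -r0; apply: hr.
  have e0 : (0 : R) < 2^-1 ^+ n.+1 by rewrite exprn_gt0.
  have [N nN eN] := eventually_bounded_bump n ts r0 r1 rb er e0.
  exists N => _; split => //; split.
  - by rewrite /bump ltn0 addr0.
  - move=> i j ij; rewrite /bump; apply: lerD; first exact: hr.
    by rewrite ler_nat; case: ltnP => // Ni; rewrite (leq_trans Ni ij).
  - move=> i; rewrite /bump -[n.+2%:R]natr1; apply: lerD => //.
    by case: (N < i)%N.
  - rewrite (_ : c n.+1 = c n + 2^-1 ^+ n.+1)// /c exprS.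
    by move: (2^-1 ^+ n) => t; field.
have [N hN] := choice stepP.
pose rr := fix rr n := if n is n'.+1 then bump (N (n', rr n')) (rr n') else (fun=> 1) : nat -> R.
have invr n : Inv n (rr n).
  elim: n => [|n ih]; last by have [] := hN (n, rr n) ih.
  split => // f sf wf; rewrite /c expr0 addrK; apply: hc0 => //.
  apply: word_bound_le wf => p; rewrite /roumieu_weight expr1n !mul1r.
  by rewrite /product_seq big1_eq mul1r.
have nN n : (n <= N (n, rr n))%N by have [] := hN (n, rr n) (invr n).
have rrS n i : rr n.+1 i = rr n i + (N (n, rr n) < i)%:R by [].
have rr_mono m n i : (m <= n)%N -> rr m i <= rr n i.
  move=> /subnK <-; elim: (n - m)%N => [//|k ih]; apply: le_trans ih _.
  by rewrite addSn rrS lerDl.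
(* Step [n] changes only indices beyond some [N >= n], so the diagonal sequence agrees with [rr n]
   up to index [n]. *)
have rr_stable n i : (i <= n)%N -> rr n i = rr i i.
  move=> /subnK <-; elim: (n - i)%N => [//|k ih]; rewrite addSn rrS ih.
  by rewrite ltnNge (leq_trans (leq_addl k i) (nN _)) addr0.
pose r i := rr i i.
have cr : classR r.
  split => //.
  - move=> m n mn; rewrite /r -(rr_stable n m mn).
    by have [_ hr _ _] := invr n; exact: hr.
  - apply/cvgryPge => A.
    (* Each of the [n] steps adds 1 at large indices, and the diagonal dominates [rr n] from index
       [n] on. *)
    have big n : exists I, forall i, (I <= i)%N -> n.+1%:R <= rr n i.
      elim: n => [|n [I hI]]; first by exists 0%N.
      exists (maxn I (N (n, rr n)).+1) => i; rewrite geq_max => /andP[Ii Ni].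
      by rewrite rrS Ni -[n.+2%:R]natr1 lerD// hI.
    have [I hI] := big (Num.truncn A); exists (maxn I (Num.truncn A)) => // i /=.
    rewrite geq_max => /andP[Ii Ai]; apply: le_trans (ltW (truncnS_gt A)) _.
    by apply: le_trans (hI i Ii) _; exact: rr_mono.
have r1 := classR_ge1 cr.
have unit_ball f : test_function M f ->
    word_bound setT (fun p => product_seq r p * M p) f -> cmod (T f) <= c0 + 1.
  move=> tf wf; have [m [C [h [m0 [C0 h0] sf f0 wCh]]]] := (test_functionP M_gt0 f).1 tf.
  (* This [n] makes [f] obey the bound for [rr n]: up to order [n] the sequence agrees with [r], and
     later factors are at least [h], so there the Roumieu bound suffices. Using [2 * h] in
     [geometric_le_product_seq] leaves a factor [2 ^+ n] to absorb [C * B]. *)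
  have [n hn Cn] : exists2 n, h <= r n & C * h ^+ n <= product_seq r n.
    have h20 : 0 < 2 * h by rewrite mulr_gt0.
    have [B B0 hB] := geometric_le_product_seq cr h20.
    have [n1 hn1] := classR_ge h cr.
    pose q := Num.truncn (C * B); pose n := maxn n1 q.+1.
    exists n; first by apply: hn1; rewrite leq_maxl.
    have q2 : C * B <= 2 ^+ n.
      apply: le_trans (ltW (truncnS_gt _)) _; rewrite -natrX ler_nat -/q.
      by apply: leq_trans (leq_maxr n1 _) _; exact/ltnW/ltn_expl.
    have Bn : 0 < (2 : R) ^+ n by rewrite exprn_gt0.
    rewrite -(ler_pM2l Bn); have -> : 2 ^+ n * (C * h ^+ n) = C * (2 * h) ^+ n by rewrite exprMn; ring.
    apply: le_trans (_ : C * (B * product_seq r n) <= _).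
      by apply: ler_wpM2l.
    by rewrite mulrA; apply: ler_wpM2r => //; apply/ltW/product_seq_gt0.
  have [rn0 hrn _ en] := invr n.
  have head p : (p <= n)%N -> product_seq (rr n) p = product_seq r p.
    move=> pn; apply: eq_big_nat => i /andP[_ ip]; rewrite rr_stable//.
    by rewrite (leq_trans _ pn).
  have Prr p : 0 < product_seq (rr n) p.
    by apply: product_seq_gt0 => i; rewrite -rn0; apply: hrn.
  have tail k : C * h ^+ (k + n) <= product_seq (rr n) (k + n).
    elim: k => [|k ih]; first by rewrite head.
    rewrite addSn product_seqS exprSr mulrA; apply: ler_pM => //.
    - by rewrite mulr_ge0// exprn_ge0// ltW.
    - exact: ltW.
    - by apply: le_trans hn _; apply: hrn; rewrite leqW// leq_addl.
  have wrr : word_bound setT (fun p => product_seq (rr n) p * M p) f.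
    move=> s x Ix; have [sn|ns] := leqP (size s) n; first by rewrite head//; exact: wf.
    apply: le_trans (wCh s x Ix) _; rewrite /roumieu_weight mulrA.
    by apply: ler_wpM2r; [exact: ltW|rewrite -(subnK (ltnW ns)); exact: tail].
  have [m1 hm1] := en f sf wrr.
  have -> : f = cmul (chi (maxn m m1)) f.
    apply/funext => x; rewrite /cmul.
    have [xm|xm] := leP `|x| (m%:R : R); last by rewrite f0// mulr0.
    rewrite chi_1 ?mul1r// ?leq_max ?m0//; apply: le_trans xm _.
    rewrite -natrM ler_nat; apply: leq_trans (leq_maxl m m1) _.
    by rewrite leq_pmull.
  apply: le_trans (hm1 _ (leq_maxr _ _) _) _; first by rewrite leq_max m0.
  by rewrite /c gerDl oppr_le0 exprn_ge0.
exists r, (c0 + 1); split => //; first by lra.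
move=> f A tf A0 wf; have sf := test_function_smooth M_gt0 tf.
(* The general case scales by [A^-1]; for [A = 0] the bound at order zero forces [f = 0]. *)
have [A_eq0|A_neq0] := eqVneq A 0.
  have -> : f = 0.
    apply/funext => x; apply: cmod_eq0.
    by have := wf [::] x I; rewrite A_eq0 mul0r.
  by rewrite T_0 ComplexField.Normc.normc0 A_eq0 mulr0.
have A_gt0 : 0 < A by rewrite lt_neqAle eq_sym A_neq0.
pose a : R[i] := (A^-1 +i* 0)%C.
have ca : cmod a = A^-1 by rewrite cmod_real gtr0_norm// invr_gt0.
have := unit_ball (a *: f) (test_functionZ M_gt0 a tf) _.
rewrite T_Z// ComplexField.Normc.normcM ca ler_pdivrMl// mulrC; apply.
apply: word_bound_le (word_boundZ a sf wf) => p.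
by rewrite ca mulrA mulVf// mul1r.
Qed.

End Equivalences.

(** * The cycle of implications *)

Theorem mainTheorem1 (R : realType) (d : nat) (M : nat -> R)
    (T : cfun R d -> R[i]) :
  (0 < d)%N ->
  (forall p, 0 < M p) -> M 0%N = 1 ->
  (exists A H : R, [/\ 0 < A, 1 <= H, M1 M, M2 A H M & M3 A M]) ->
  ultradistribution M T ->
  [<-> (* (a) *)
       exists (r : nat -> R) (C : R), [/\ classR r, 0 < C & forall f : cfun R d,
         test_function M f ->
         ((cmod (T f))%:E <= C%:E * R_norm M r f)%E];
       (* (b) *)
       exists r : nat -> R, classR r /\ forall eps : R, 0 < eps ->
         exists K : set 'rV[R]_d, regular_compact K /\
           forall f : cfun R d, test_function M f -> supp f `&` K = set0 ->
           ((cmod (T f))%:E <= eps%:E * R_norm M r f)%E;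
       (* (c) *)
       forall P : nat -> cfun R d, approximate_unit M P ->
         cauchy ((fun n => T (P n) : R[i]^o) @ \oo);
       (* (d) *)
       forall P : nat -> cfun R d, special_approximate_unit M P ->
         cauchy ((fun n => T (P n) : R[i]^o) @ \oo);
       (* (e) *)
       exists (r : nat -> R) (C : R) (K : set 'rV[R]_d),
         [/\ classR r, 0 < C, regular_compact K & forall f : cfun R d,
         test_function M f -> supp f `&` K = set0 ->
         ((cmod (T f))%:E <= C%:E * R_norm M r f)%E]].
Proof.
move=> _ M_gt0 M_0 [A [_ [_ _ m1 _ m3]]] T_ultra.
have Msup i j := log_convex_supermul i j M_gt0 M_0 m1.
have [H [chi [H1 chis chib chi1 chi0]]] := @cutoffs_exist R d M M_gt0 M_0 Msup A m3.
have K1 : regular_compact (cube 1 : set 'rV[R]_d) by apply: cube_regular.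
have e_vanishing : (exists (r : nat -> R) (C : R) (K : set 'rV[R]_d),
    [/\ classR r, 0 < C, regular_compact K & forall f : cfun R d,
      test_function M f -> supp f `&` K = set0 ->
      ((cmod (T f))%:E <= C%:E * R_norm M r f)%E]) -> vanishing_at_infinity M T.
  move=> [r [C [K [cr C0 [cK _ _ _] hC]]]].
  apply: (continuous_off_vanishing M_gt0 T_ultra cr C0 cK).
  exact: (continuous_offP T M_gt0 K cr (ltW C0)).2 hC.
have tail_a : tail_small M T -> exists (r : nat -> R) (C : R),
    [/\ classR r, 0 < C & forall f : cfun R d, test_function M f ->
      ((cmod (T f))%:E <= C%:E * R_norm M r f)%E].
  move=> ts; have [r [C [cr C0 hC]]] :=
    tail_small_continuous M_gt0 Msup T_ultra H1 chis chib chi1 chi0 ts.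
  exists r, C; split => // f tf.
  have [B [B0 -> wB]] := test_R_norm_fin M_gt0 cr tf.
  by rewrite -EFinM lee_fin; exact: hC.
have a_e : (exists (r : nat -> R) (C : R), [/\ classR r, 0 < C &
    forall f : cfun R d, test_function M f ->
      ((cmod (T f))%:E <= C%:E * R_norm M r f)%E]) ->
    exists (r : nat -> R) (C : R) (K : set 'rV[R]_d),
    [/\ classR r, 0 < C, regular_compact K & forall f : cfun R d,
      test_function M f -> supp f `&` K = set0 ->
      ((cmod (T f))%:E <= C%:E * R_norm M r f)%E].
  by move=> [r [C [cr C0 hC]]]; exists r, C, (cube 1); split => // f tf _; exact: hC.
(* (a) gives (b) through (e), (d) gives (e) through (a), and (e) gives (a) through (b). *)
tfae.
- move=> /a_e /e_vanishing [r [cr hr]]; exists r; split => // eps eps0.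
  have [K [rK hK]] := hr eps eps0; exists K; split => //.
  exact: (continuous_offP T M_gt0 K cr (ltW eps0)).1 hK.
- move=> [r [cr hr]].
  apply: (vanishing_cauchy M_gt0 M_0 Msup T_ultra H1 chis chib chi1 chi0).
  exists r; split => // eps eps0; have [K [rK hK]] := hr eps eps0; exists K; split => //.
  exact: (continuous_offP T M_gt0 K cr (ltW eps0)).2 hK.
- by move=> hc P [aP _]; exact: hc.
- move=> hd; apply/a_e/tail_a.
  exact: (special_tail_small M_gt0 M_0 T_ultra H1 chis chib chi1 chi0 hd).
- move=> /e_vanishing van; apply: tail_a.
  exact: (vanishing_tail_small M_gt0 van).
Qed.
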